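(* Let $P\subset\mathbb{R}^n$ be a convex polyhedron, let $D$ be its double and let $\mathcal{S}\subset D$ be the singular set. Then for every $\varepsilon>0$ the $\varepsilon$-neighbourhood $U_\varepsilon$ of $\mathcal{S}$ in $D$ satisfies the finite tube condition: there exists a finite collection of periodic tubes $T_1,\dots,T_N$ in $D_0=D\setminus\mathcal{S}$ such that any orbit that avoids $U_\varepsilon$ belongs to some $T_i$.
   Context: The singular set $\mathcal{S}$ of $P$ is the $(n-2)$-skeleton of $\partial P$ (the union of faces of dimension $\le n-2$). The double of $P$ is $D=(P\sqcup\sigma P)/\sim$, where $\sigma$ is a reflection of $\mathbb{R}^n$, $\sigma P$ is the copy of $P$ under it, and $\sim$ identifies pointwise the corresponding faces of $\partial P$ and $\partial(\sigma P)$; the image of the $(n-2)$-skeleton in $D$ is again denoted $\mathcal{S}$, and $D_0:=D\setminus\mathcal{S}$ is a flat (open Euclidean) $n$-manifold. Orbits are the trajectories of the geodesic flow on $D_0$; they correspond to billiard trajectories in $P$ (unit speed straight-line motion with reflection at the faces according to the law of light reflection, stopped upon hitting $\mathcal{S}$). Tubes: given a set $V\subset\mathbb{R}^{n-1}$ (the cross-section) and a local isometry $F:V\times\mathbb{R}\to D_0$, the image $F(V\times\mathbb{R})$ is called an (immersed) tube. It is called periodic if there are a number $L>0$ (the length) and a rotation $\mathcal{R}$ of $\mathbb{R}^n$ fixing the $\mathbb{R}$-direction (and identified with the rotation it induces on $\mathbb{R}^{n-1}$) such that $F(x,t+L)=F(\mathcal{R}x,t)$ for all $x\in V$ and $t\in\mathbb{R}$.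 An orbit belongs to the tube if it is one of the parallel trajectories $t\mapsto F(x,t)$, $x\in V$. *)

(* Defs.v *)
From HB Require Import structures.
From mathcomp Require Import all_boot all_order all_algebra.
From mathcomp Require Import generic_quotient.
From mathcomp Require Import all_classical all_reals all_analysis.
From mathcomp Require Import lra.
Import Order.TTheory GRing.Theory Num.Theory numFieldNormedType.Exports.

Set Implicit Arguments.
Unset Strict Implicit.
Unset Printing Implicit Defensive.

Local Open Scope classical_set_scope.
Local Open Scope ring_scope.
Local Open Scope quotient_scope.

Section Euclidean.
Context {R : realType} {n : nat}.
Implicit Types u v w : 'rV[R]_n.

Definition dot u v : R := \sum_i u 0 i * v 0 i.

(* The norm `|u| of the library is the sup norm on row vectors. *)
Definition enorm u : R := Num.sqrt (dot u u).

Definition edist u v : R := enorm (u - v).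

Lemma dotuu_ge0 u : 0 <= dot u u.
Proof. by apply: sumr_ge0 => i _; rewrite -expr2 sqr_ge0. Qed.

Lemma dotC u v : dot u v = dot v u.
Proof. by apply: eq_bigr => i _; rewrite mulrC. Qed.

Lemma dotDZ (a b : R) u v w : dot (a *: u + b *: v) w = a * dot u w + b * dot v w.
Proof.
rewrite /dot !mulr_sumr -big_split /=; apply: eq_bigr => i _.
by rewrite !mxE mulrDl !mulrA.
Qed.

Lemma dot_sqr (a b : R) u v : dot (a *: u + b *: v) (a *: u + b *: v) =
  a ^+ 2 * dot u u + 2 * a * b * dot u v + b ^+ 2 * dot v v.
Proof. by rewrite dotDZ !(dotC _ (_ + _)) !dotDZ (dotC v u); lra. Qed.

Lemma dot_le_enorm u v : dot u v <= enorm u * enorm v.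
Proof.
have uv0 : 0 <= enorm u * enorm v by rewrite mulr_ge0 ?sqrtr_ge0.
have [uv|/ltW uv] := lerP (dot u v) 0; first exact: le_trans uv uv0.
rewrite -[leLHS]ger0_norm // -[leRHS]ger0_norm // -ler_sqr ?nnegrE //.
rewrite -!normrX !ger0_norm ?sqr_ge0 // exprMn !sqr_sqrtr ?dotuu_ge0 //.
have [v0|v0] := eqVneq (dot v v) 0.
  rewrite v0 mulr0.
  have /(_ (- (dot u u + 1))) := fun t => dotuu_ge0 (1 *: u + t *: v).
  have := dotuu_ge0 (1 *: u + (- (dot u u + 1) / dot u v) *: v).
  have [->|d0 h _] := eqVneq (dot u v) 0; first by rewrite expr0n.
  move: h; rewrite dot_sqr v0 mulr0 addr0 expr1n mul1r mulr1 -mulrA divfK //.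
  by have := dotuu_ge0 u; lra.
have v_gt0 : 0 < dot v v by rewrite lt_def v0 dotuu_ge0.
have := dotuu_ge0 (dot v v *: u + (- dot u v) *: v).
rewrite dot_sqr => h; rewrite -(ler_pM2l v_gt0) -subr_ge0.
by apply: le_trans h _; rewrite le_eqVlt; apply/orP; left; apply/eqP; lra.
Qed.

Lemma edistC u v : edist u v = edist v u.
Proof.
congr Num.sqrt; apply: eq_bigr => i _.
by rewrite !mxE -mulrNN !opprB.
Qed.

Lemma edistuu u : edist u u = 0.
Proof.
by rewrite /edist /enorm subrr /dot big1 ?sqrtr0 // => i _; rewrite mxE mul0r.
Qed.

Lemma edist_ge0 u v : 0 <= edist u v.
Proof. exact: sqrtr_ge0. Qed.

Lemma edist_triangle u v w : edist u w <= edist u v + edist v w.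
Proof.
rewrite -[leLHS]ger0_norm ?edist_ge0 // -[leRHS]ger0_norm ?addr_ge0 ?edist_ge0 //.
rewrite -ler_sqr ?nnegrE // -!normrX !ger0_norm ?sqr_ge0 //.
rewrite /edist [u - w](_ : _ = 1 *: (u - v) + 1 *: (v - w)); last first.
  by rewrite !scale1r addrA subrK.
have := dot_le_enorm (u - v) (v - w).
rewrite sqrrD !sqr_sqrtr ?dotuu_ge0 // dot_sqr; lra.
Qed.

End Euclidean.

(* Distance-preserving near every point of the domain [A]; for a map from an
   interval to a flat manifold this says "unit-speed geodesic". *)
Definition local_isometry {R : realType} {X Y : Type} (dX : X -> X -> R)
    (dY : Y -> Y -> R) (A : set X) (f : X -> Y) : Prop :=
  forall x, A x -> exists2 r : R, 0 < r & forall y z, A y -> A z ->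
    dX x y < r -> dX x z < r -> dY (f y) (f z) = dX y z.

Section Polyhedron.
Context {R : realType} {m : nat}.
Let n := m.+1.
Implicit Types P G : set 'rV[R]_n.

(* Solid and bounded: these are needed for the double to be a closed
   (compact, boundaryless) flat cone manifold of dimension [n]. *)
Definition convex_polyhedron P : Prop :=
  [/\ exists (k : nat) (a : 'I_k -> 'rV[R]_n) (b : 'I_k -> R),
        P = [set x | forall i, dot (a i) x <= b i],
      bounded_set P &
      interior P !=set0].

Definition boundary P : set 'rV[R]_n := closure P `\` interior P.

Definition face P G : Prop :=
  exists (a : 'rV[R]_n) (b : R), (forall x, P x -> dot a x <= b) /\
    G = P `&` [set x | dot a x = b].

(* [G] lies in an affine subspace [c + W] with [dim W <= k]. *)
Definition affdim_le (k : nat) G : Prop :=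
  exists (c : 'rV[R]_n) (W : 'M[R]_n),
    (\rank W <= k)%N /\ forall x, G x -> (x - c <= W)%MS.

Definition skeleton P (k : nat) : set 'rV[R]_n :=
  [set x | exists G, [/\ face P G, affdim_le k G & G x]].

(* [k + 2 <= n] instead of [k = n - 2], which is truncated when [n = 1]. *)
Definition singular_points P : set 'rV[R]_n :=
  [set x | exists2 k : nat, (k + 2 <= n)%N & skeleton P k x].

End Polyhedron.

(* The reflection sigma is an isometry of P onto sigma P, so the disjoint union
   of P and sigma P is encoded as P * bool: [(x, false)] stands for x in P and
   [(x, true)] for sigma x in sigma P. *)
Definition sheets {R : realType} {m : nat} (P : set 'rV[R]_m.+1) : Type :=
  ({x : 'rV[R]_m.+1 | x \in P} * bool)%type.
HB.instance Definition _ (R : realType) (m : nat) (P : set 'rV[R]_m.+1) :=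
  Choice.on (sheets P).

Section Double.
Context {R : realType} {m : nat} (P : set 'rV[R]_m.+1).
Implicit Types p q : sheets P.

Definition glue p q : bool :=
  (p.1 == q.1) && ((p.2 == q.2) || (val p.1 \in boundary P)).

Lemma glue_refl : reflexive glue.
Proof. by move=> p; rewrite /glue !eqxx. Qed.

Lemma glue_sym : symmetric glue.
Proof.
move=> p q; rewrite /glue [q.1 == _]eq_sym [q.2 == _]eq_sym.
by case: eqP => //= ->.
Qed.

Lemma glue_trans : transitive glue.
Proof.
move=> q p r /andP[/eqP pq h] /andP[/eqP qr k].
rewrite /glue pq qr eqxx /=; move: h k; rewrite pq qr.
by case: (_ \in _); rewrite ?orbT // !orbF => /eqP ->.
Qed.

Canonical glue_equiv := EquivRel glue glue_refl glue_sym glue_trans.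

Definition pdouble : Type := {eq_quot glue_equiv}.
HB.instance Definition _ := Choice.on pdouble.
HB.instance Definition _ := EqQuotient.on pdouble.

(* Metric of the gluing of P and sigma P along their common boundary. *)
Definition sheets_dist p q : R :=
  if p.2 == q.2 then edist (val p.1) (val q.1)
  else inf [set edist (val p.1) z + edist z (val q.1) | z in boundary P].

Definition ddist (p q : pdouble) : R := sheets_dist (repr p) (repr q).

Lemma sheets_distC p q : sheets_dist p q = sheets_dist q p.
Proof.
rewrite /sheets_dist eq_sym edistC; case: ifP => // _.
congr inf; apply/seteqP; split=> _ [z bz <-]; exists z => //;
  by rewrite addrC ![edist _ z]edistC ![edist z _]edistC.
Qed.

Lemma inf_through_boundary (x y : 'rV[R]_m.+1) : boundary P x ->
  inf [set edist x z + edist z y | z in boundary P] = edist x y.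
Proof.
move=> bx; apply/eqP; rewrite eq_le; apply/andP; split.
  apply: ge_inf; first by exists 0 => _ [z _ <-]; rewrite addr_ge0 ?edist_ge0.
  by exists x => //; rewrite edistuu add0r.
apply: lb_le_inf; first by exists (edist x x + edist x y), x.
by move=> _ [z _ <-]; exact: edist_triangle.
Qed.

Lemma sheets_dist_gluel p p' q : glue p p' -> sheets_dist p q = sheets_dist p' q.
Proof.
case: p p' => [x s] [x' s'] /andP[/= /eqP<- /orP[/eqP<-//|/set_mem bx]].
by rewrite /sheets_dist /= inf_through_boundary // !if_same.
Qed.

Lemma ddist_pi p q : ddist (\pi_pdouble p) (\pi_pdouble q) = sheets_dist p q.
Proof.
have gl r : glue (repr (\pi_pdouble r)) r.
  by have /eqmodP := reprK (\pi_pdouble r).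
by rewrite /ddist (sheets_dist_gluel _ (gl p)) sheets_distC
  (sheets_dist_gluel _ (gl q)) sheets_distC.
Qed.

Definition singular_set : set pdouble :=
  [set p | exists2 q : sheets P, singular_points P (val q.1) & p = \pi_pdouble q].

Definition regular_part : set pdouble := ~` singular_set.

Definition singular_nbhd (eps : R) : set pdouble :=
  [set p | exists2 s, singular_set s & ddist p s < eps].

(* A trajectory is a unit-speed geodesic of [regular_part] on an open time
   interval ]a, b[; a finite end of the interval is a time at which it hits the
   singular set. *)
Definition is_orbit (a b : \bar R) (gamma : R -> pdouble) : Prop :=
  let I := [set t : R | (a < t%:E)%E /\ (t%:E < b)%E] in
  [/\ (a < b)%E,
      forall t, I t -> regular_part (gamma t),
      local_isometry (fun s t => `|s - t|) ddist I gamma,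
      forall t0, a = t0%:E -> exists2 s, singular_set s &
        ddist (gamma t) s @[t --> t0^'+] --> (0 : R) &
      forall t0, b = t0%:E -> exists2 s, singular_set s &
        ddist (gamma t) s @[t --> t0^'-] --> (0 : R)].

Definition orbit_avoids (a b : \bar R) (gamma : R -> pdouble) (U : set pdouble) :
    Prop :=
  forall t : R, (a < t%:E)%E -> (t%:E < b)%E -> ~ U (gamma t).

(* R^m x R as R^n, the R-direction being the first coordinate. *)
Definition cyl (x : 'rV[R]_m) (t : R) : 'rV[R]_(1 + m) := row_mx t%:M x.

Definition cyl_dist (p q : 'rV[R]_m * R) : R :=
  edist (cyl p.1 p.2) (cyl q.1 q.2).

(* Values of [tube_map] outside [cross_section x R] are irrelevant. *)
Record tube := Tube {
  cross_section : set 'rV[R]_m ;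
  tube_map : 'rV[R]_m * R -> pdouble ;
  tube_regular : forall x t, cross_section x -> regular_part (tube_map (x, t)) ;
  tube_local_isometry :
    local_isometry cyl_dist ddist (cross_section `*` setT) tube_map }.

(* Matrices act on row vectors on the right. *)
Definition axial_rotation (Q : 'M[R]_(1 + m)) : Prop :=
  [/\ Q *m Q^T = 1%:M, \det Q = 1 & cyl 0 1 *m Q = cyl 0 1].

Definition periodic_tube (T : tube) : Prop :=
  exists (L : R) (Q : 'M[R]_(1 + m)), [/\ 0 < L, axial_rotation Q &
    forall x, cross_section T x ->
      let Qx := x *m drsubmx Q in
      cross_section T Qx /\
      forall t, tube_map T (x, t + L) = tube_map T (Qx, t)].

(* An orbit is a trajectory up to the choice of the origin of time. *)
Definition belongs_to (a b : \bar R) (gamma : R -> pdouble) (T : tube) : Prop :=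
  [/\ a = -oo%E, b = +oo%E &
    exists (x : 'rV[R]_m) (c : R), cross_section T x /\
      forall t, gamma t = tube_map T (x, t + c)].

Definition finite_tube_condition (U : set pdouble) : Prop :=
  exists (N : nat) (T : 'I_N -> tube), (forall i, periodic_tube (T i)) /\
    forall (a b : \bar R) (gamma : R -> pdouble),
      is_orbit a b gamma -> orbit_avoids a b gamma U ->
      exists i, belongs_to a b gamma (T i).

End Double.

(* Main.v *)
From Pilot Require Import Defs.
From mathcomp Require Import all_boot all_order all_algebra.
From mathcomp Require Import generic_quotient.
From mathcomp Require Import all_classical all_reals all_analysis.
From mathcomp Require Import zify lra ring.
Import Order.TTheory GRing.Theory Num.Theory numFieldNormedType.Exports.

(** An orbit that keeps the distance [eps] from the singular set is a complete
    billiard trajectory, hence a bi-infinite sequence of bounces; its code is the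
    sequence of the faces that it hits. A compactness argument provides a uniform
    [rho > 0] such that each bounce point is [rho] away from all faces but its own.
    The theorem follows from a statement about codes: only finitely many codes
    occur, and all of them are periodic ([bounce_codes_finite],
    [bounce_codes_periodic]).

    Geometry of codes. Two trajectories with the same future code are parallel
    after unfolding, since otherwise the unfolded lines would diverge while the
    trajectories stay in the same copies of a bounded polyhedron
    ([pair_parallel]). If their codes differ one step earlier, then the parallel
    lines are at distance at least [rho] from each other ([branching_perp]). For a
    code [f], consider the largest number of trajectories that have the future of
    [f] and are pairwise [rho] apart. This number is bounded, since the lines meet
    a bounded cross-section ([packing_bound]). It is upper semicontinuous
    ([packing_closed]). It does not decrease when the code is translated
    ([packing_shift]), and where two pasts merge it is at least the sum of the
    numbers for the two pasts ([packing_add]).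

    Symbolic dynamics. Take a code of maximal number in the omega-limit set of a
    given code. In its own omega-limit set the number is constant, so that no two
    pasts ever merge there; by compactness such a set consists of periodic codes
    ([omega_has_periodic]). Conversely, a periodic code [q] cannot merge with
    another one, forwards or backwards, because the number would grow strictly
    over one period. Hence [q] is isolated ([periodic_isolated]), and a code that
    accumulates at [q] is a translate of [q] ([codes_periodic]). A compact set of
    isolated points is finite ([codes_finite]).

    Geometry of tubes. The orbits with a given code, starting on a given sheet,
    are parallel. Parametrized by their traces on a hyperplane orthogonal to the
    common direction, they form a tube: near each point one flat chart of the
    double contains all neighbouring orbits ([member_local_isometry]). Advancing
    by an even period of the code is an affine isometry of the cross-section. The
    cross-section is bounded, so this isometry has a fixed point
    ([isometry_fixpoint]), which is chosen as the origin; the square of the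
    isometry is then the required rotation ([tube_of_members]). *)

Set Implicit Arguments.
Unset Strict Implicit.
Unset Printing Implicit Defensive.

Local Open Scope classical_set_scope.
Local Open Scope ring_scope.

Local Notation edist := Pilot.Defs.edist.

(** * Limits along an ultrafilter *)

(** Limits along one fixed free ultrafilter replace the passage to
    subsequences: a single filter serves all coordinates at once. *)
Lemma free_ultrafilter :
  exists U : set_system nat, UltraFilter U /\ (forall n, U [set j | (n <= j)%N]).
Proof.
have [U [hU sub]] := ultraFilterLemma eventually_filter.
by exists U; split => // n; apply: sub; exists n.
Qed.

Lemma ultra_finite (T : Type) (I : finType) (U : set_system T) (h : T -> I) :
  UltraFilter U -> exists i, U [set t | h t = i].
Proof.
move=> hU; apply: contrapT => /forallNP no.
have : U (fun t => forall i, h t <> i).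
  apply: (@filter_forall T I (fun i t => h t <> i)) => i.
  by have [/no|] := in_ultra_setVsetC [set t | h t = i] hU.
by move=> /filter_ex[t /(_ (h t))].
Qed.

Section SequenceSpace.
Variable I : finType.
Implicit Types f g : int -> I.

Definition translate (c : int) f : int -> I := fun k => f (k + c).
Definition reverse f : int -> I := fun k => f (- k).
Definition agree (n : nat) f g := forall k : int, `|k| <= n%:Z -> f k = g k.
Definition periodic f := exists2 p : nat, (0 < p)%N & forall k, f (k + p%:Z) = f k.
Definition closed_codes (X : set (int -> I)) :=
  forall f, (forall n, exists2 g, X g & agree n g f) -> X f.

Lemma translateD c d f : translate c (translate d f) = translate (c + d) f.
Proof. by apply/funext => k; rewrite /translate addrA. Qed.

Lemma translate0 f : translate 0 f = f.
Proof. by apply/funext => k; rewrite /translate addr0. Qed.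

Lemma seq_limit (y : nat -> int -> I) :
  exists f, forall n m : nat, exists2 j : nat, (m <= j)%N & agree n (y j) f.
Proof.
have [U [hU ge]] := free_ultrafilter.
have /choice[f hf] : forall k : int, exists i, U [set j | y j k = i].
  by move=> k; exact: ultra_finite.
exists f => n m.
have : U (fun j => forall i : 'I_n.+1, y j i%:Z = f i%:Z /\ y j (- i%:Z) = f (- i%:Z)).
  apply: (@filter_forall _ _ (fun (i : 'I_n.+1) j =>
    y j i%:Z = f i%:Z /\ y j (- i%:Z) = f (- i%:Z))) => i.
  exact: filterI (hf _) (hf _).
move=> /(filterI (ge m)) /filter_ex[j [mj hj]]; exists j => // k kn.
have kl : (`|k| < n.+1)%N by lia.
have /= [h1 h2] := hj (Ordinal kl).
have [->|->] : k = `|k|%N%:Z \/ k = - `|k|%N%:Z by lia.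
  exact: h1.
exact: h2.
Qed.

End SequenceSpace.

Section PairLimit.
Variable I : finType.

Lemma seq_limit2 (X Y : set (int -> I)) (y z : nat -> int -> I) :
  closed_codes X -> closed_codes Y -> (forall j, X (y j)) -> (forall j, Y (z j)) ->
  exists f g, [/\ X f, Y g & forall n m : nat, exists j : nat,
    [/\ (m <= j)%N, agree n (y j) f & agree n (z j) g]].
Proof.
move=> cX cY Xy Yz.
have [h hh] := seq_limit (fun j k => (y j k, z j k)).
have hh' n m : exists j : nat,
    [/\ (m <= j)%N, agree n (y j) (fun k => (h k).1) & agree n (z j) (fun k => (h k).2)].
  have [j mj hj] := hh n m; exists j; split=> // k /hj <- //.
exists (fun k => (h k).1), (fun k => (h k).2); split => //.
  by apply: cX => n; have [j [_ ? _]] := hh' n 0%N; exists (y j).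
by apply: cY => n; have [j [_ _ ?]] := hh' n 0%N; exists (z j).
Qed.

End PairLimit.

(** * Codes with a bounded superadditive count are finite in number *)

Section Symbolic.
Variable I : finType.
Implicit Types (f g q x : int -> I) (Y : set (int -> I)).

Definition omega x : set (int -> I) := [set g | forall n m : nat,
  exists2 k : nat, (m <= k)%N & agree n (translate k%:Z x) g].

Definition shift_invariant Y := forall f (c : int), Y f -> Y (translate c f).

Definition unbranched Y := forall f g, Y f -> Y g ->
  (forall k, 1 <= k -> f k = g k) -> f 0 = g 0.

Lemma omega_nonempty x : exists g, omega x g.
Proof. by have [g hg] := seq_limit (fun j => translate j%:Z x); exists g. Qed.

Lemma omega_closed x : closed_codes (omega x).
Proof.
move=> f hf n m; have [g hg gf] := hf n; have [k mk kg] := hg n m.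
by exists k => // r rn; rewrite kg // gf.
Qed.

Lemma omega_shift x : shift_invariant (omega x).
Proof.
move=> g c hg n m; have [k mk hk] := hg (n + `|c|)%N (m + `|c|)%N.
exists `|(k%:Z + c)%R|%N; first lia.
move=> r rn; rewrite /translate.
have -> : r + `|(k%:Z + c)%R|%N%:Z = (r + c) + k%:Z by lia.
by rewrite -hk //; lia.
Qed.

Lemma omega_sub x Y : closed_codes Y -> shift_invariant Y -> Y x -> omega x `<=` Y.
Proof.
move=> cY sY Yx g hg; apply: cY => n; have [k _ hk] := hg n 0%N.
by exists (translate k%:Z x) => //; exact: sY.
Qed.

(** Uniqueness of the symbol preceding a future makes, by compactness, each
    symbol a function of the next [N] symbols; two equal windows then force a
    period on everything before them, and the period is bounded by the number
    of windows. *)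
Lemma unbranched_periodic Y f : closed_codes Y -> shift_invariant Y ->
  unbranched Y -> Y f -> periodic f.
Proof.
move=> cY sY uY Yf.
have [N hN] : exists N : nat, forall g h, Y g -> Y h ->
    (forall k : int, 1 <= k <= N%:Z -> g k = h k) -> g 0 = h 0.
  apply: contrapT => /forallNP no.
  have /choice[gh ghP] : forall N : nat, exists gh : (int -> I) * (int -> I),
      [/\ Y gh.1, Y gh.2, (forall k : int, 1 <= k <= N%:Z -> gh.1 k = gh.2 k)
        & gh.1 0 <> gh.2 0].
    move=> N; have /existsNP[g] := no N.
    move=> /existsNP[h] /not_implyP[Yg] /not_implyP[Yh] /not_implyP[e ne].
    by exists (g, h).
  have [||||g [h [Yg Yh lim]]] := @seq_limit2 I Y Y (fun j => (gh j).1) (fun j => (gh j).2).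
  - exact: cY.
  - exact: cY.
  - by move=> j; have [] := ghP j.
  - by move=> j; have [] := ghP j.
  have [j [_ jg jh]] := lim 0%N 0%N; have [_ _ _] := ghP j; apply.
  rewrite jg // jh //; apply: uY => // k k1.
  have [i [ki ig ih]] := lim `|k|%N `|k|%N; have [_ _ e _] := ghP i.
  by rewrite -ig ?e -?ih //; lia.
pose w (i : nat) := [ffun r : 'I_N => f (i%:Z + 1 + r%:Z)].
set K := #|{: {ffun 'I_N -> I}}|.
have back (i j : nat) : w i = w j -> forall d : nat, f (i%:Z - d%:Z) = f (j%:Z - d%:Z).
  move=> wij.
  have wE r : 0 <= r < N%:Z -> f (i%:Z + 1 + r) = f (j%:Z + 1 + r).
    move=> /andP[r0 rN]; have rl : (`|r| < N)%N by lia.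
    have := congr1 (fun F : {ffun 'I_N -> I} => F (Ordinal rl)) wij; rewrite !ffunE /=.
    by have -> : `|r|%N%:Z = r by lia.
  suff H : forall d : nat, forall r, - d%:Z <= r < N%:Z ->
      f (i%:Z + 1 + r) = f (j%:Z + 1 + r).
    move=> d; have := H d.+1 (- d.+1%:Z).
    have -> : forall k : nat, k%:Z + 1 - d.+1%:Z = k%:Z - d%:Z by move=> k; lia.
    have -> : j%:Z + 1 - d.+1%:Z = j%:Z - d%:Z by lia.
    by apply; lia.
  elim=> [|d IH] r rd; first by apply: wE; lia.
  have [rd'|rd'] := lerP (- d%:Z) r; first by apply: IH; lia.
  have -> : r = - d.+1%:Z by lia.
  have := hN (translate (i%:Z + 1 - d.+1%:Z) f) (translate (j%:Z + 1 - d.+1%:Z) f)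
    (sY _ _ Yf) (sY _ _ Yf).
  rewrite /translate !add0r; apply => k /andP[k1 kN].
  have -> : k + (i%:Z + 1 - d.+1%:Z) = i%:Z + 1 + (k - d.+1%:Z) by lia.
  have -> : k + (j%:Z + 1 - d.+1%:Z) = j%:Z + 1 + (k - d.+1%:Z) by lia.
  by apply: IH; lia.
have per (n : nat) : exists2 p : nat, (0 < p <= K)%N &
    forall k : int, k <= n%:Z -> f (k + p%:Z) = f k.
  have : ~ injective (fun i : 'I_K.+1 => w (n + i)%N).
    by move=> /leq_card; rewrite card_ord ltnn.
  move=> /existsNP[i] /existsNP[j] /not_implyP[e ne].
  wlog ij : i j e ne / (i < j)%N.
    move=> H; have [l|l|l] := ltngtP i j; first exact: (H i j).
      by apply: (H j i) => // c; apply: ne.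
    by case: ne; apply/val_inj.
  exists (j - i)%N; first by have := ltn_ord j; lia.
  move=> k kn.
  have := back _ _ e `|((n + i)%N%:Z - k)%R|%N.
  have -> : (n + i)%N%:Z - `|((n + i)%N%:Z - k)%R|%N%:Z = k by lia.
  by have -> : (n + j)%N%:Z - `|((n + i)%N%:Z - k)%R|%N%:Z = k + (j - i)%N%:Z by lia.
(* A multiple of every number from 1 to [K], hence of all the local periods. *)
exists K`!; first exact: fact_gt0.
move=> k; have [p /andP[p0 pK] hp] := per (`|k| + K`!)%N.
have /dvdnP[c cE] : (p %| K`!)%N by apply: dvdn_fact; rewrite p0.
suff H : forall d : nat, (d * p <= K`!)%N -> f (k + (d * p)%N%:Z) = f k.
  by rewrite {1}cE; apply: H; rewrite cE.
elim=> [|d IH] dc; first by rewrite mul0n addr0.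
have -> : k + (d.+1 * p)%N%:Z = k + (d * p)%N%:Z + p%:Z by lia.
by rewrite hp; [apply: IH; lia | lia].
Qed.

(** In the application, [pack p f] says that [p] separated orbits have the future
    of [f]. *)
Section Packing.
Variable X : set (int -> I).
Variable pack : nat -> (int -> I) -> Prop.
Variable M : nat.
Hypothesis X_closed : closed_codes X.
Hypothesis X_shift : shift_invariant X.
Hypothesis X_rev : forall f, X f -> X (reverse f).
Hypothesis pack1 : forall f, X f -> pack 1 f.
Hypothesis pack_le : forall p f, pack p f -> (p <= M)%N.
Hypothesis pack_shift : forall p f, pack p f -> pack p (translate 1 f).
Hypothesis pack_add : forall p r f g, pack p f -> pack r g ->
  (forall k, 1 <= k -> f k = g k) -> f 0 <> g 0 -> pack (p + r) (translate 1 f).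
Hypothesis pack_closed : forall p, closed_codes (pack p).

Lemma pack_shiftn p f (k : nat) : pack p f -> pack p (translate k%:Z f).
Proof.
elim: k => [|k IH] h; first by rewrite translate0.
have -> : translate k.+1%:Z f = translate 1 (translate k%:Z f).
  by rewrite translateD; congr translate; lia.
exact: pack_shift (IH h).
Qed.

Lemma max_pack Y : Y `<=` X -> Y !=set0 ->
  exists p g, [/\ Y g, pack p g, (0 < p)%N & forall h r, Y h -> pack r h -> (r <= p)%N].
Proof.
move=> YX [g0 Yg0].
have ex : exists p, `[< exists2 g, Y g & pack p g >].
  by exists 1%N; apply/asboolP; exists g0 => //; exact/pack1/YX.
have ub p : `[< exists2 g, Y g & pack p g >] -> (p <= M)%N.
  by move=> /asboolP[g _ /pack_le].
case: (ex_maxnP ex ub) => p /asboolP[g Yg pg] pmax.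
exists p, g; split => //.
  by apply: pmax; apply/asboolP; exists g0 => //; exact/pack1/YX.
by move=> h r Yh rh; apply: pmax; apply/asboolP; exists h.
Qed.

(** Along the limit set of a code of largest count the count stays at this
    maximum, so superadditivity leaves no room for two pasts. *)
Lemma omega_has_periodic x : X x -> exists2 q, omega x q & periodic q.
Proof.
move=> Xx.
have sub := omega_sub X_closed X_shift Xx.
have [p [g [og pg p0 pmax]]] := max_pack sub (omega_nonempty x).
have sub' := omega_sub (@omega_closed x) (@omega_shift x) og.
have pk h : omega g h -> pack p h.
  move=> oh; apply: pack_closed => n; have [k _ ?] := oh n 0%N.
  by exists (translate k%:Z g) => //; exact: pack_shiftn.
have [q oq] := omega_nonempty g.
exists q; first exact: sub'.
apply: (unbranched_periodic (@omega_closed g) (@omega_shift g)) oq.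
move=> h h' oh oh' e; apply: contrapT => ne.
have := pack_add (pk _ oh) (pk _ oh') e ne.
by move/(pmax _ _ (@omega_shift _ _ 1 (sub' _ oh))); lia.
Qed.

(** Otherwise a limit of counterexamples branches off a translate of [q] at one
    place; the count of [reverse q] would grow strictly over one period. *)
Lemma periodic_right_det q : X q -> periodic q ->
  exists n : nat, forall y (c : int), X y ->
    (forall k : int, - n%:Z <= k -> k <= -1 -> y k = q (k + c)) -> y 0 = q c.
Proof.
move=> Xq [p p0 per]; apply: contrapT => /forallNP no.
have /choice[yc ycP] : forall n : nat, exists yc : (int -> I) * int,
    [/\ X yc.1, (forall k : int, - n%:Z <= k -> k <= -1 -> yc.1 k = q (k + yc.2))
      & yc.1 0 <> q yc.2].
  move=> n; have /existsNP[y] := no n.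
  move=> /existsNP[c] /not_implyP[Xy] /not_implyP[e ne].
  by exists (y, c).
have [||||y [z [Xy Xz lim]]] :=
    @seq_limit2 I X X (fun j => (yc j).1) (fun j => translate (yc j).2 q) => //.
- by move=> j; have [] := ycP j.
- by move=> j; exact: X_shift.
have zper k : z (k + p%:Z) = z k.
  have [j [_ _ jz]] := lim (`|k| + p)%N 0%N.
  by rewrite -!jz /translate; [rewrite addrAC per | lia | lia].
have yz0 : reverse y 0 <> reverse z 0.
  rewrite /reverse oppr0; have [j [_ jy jz]] := lim 0%N 0%N; have [_ _] := ycP j.
  by rewrite -jy // -jz // /translate add0r.
have yz k : 1 <= k -> reverse z k = reverse y k.
  rewrite /reverse => k1; have [j [kj jy jz]] := lim `|k|%N `|k|%N.
  by have [_ e _] := ycP j; rewrite -jy -?jz ?e //; lia.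
pose Y : set (int -> I) := [set f | exists c, f = translate c (reverse z)].
have YX : Y `<=` X by move=> _ [c ->]; exact/X_shift/X_rev.
have [|r [g [[c gE] pg r0 rmax]]] := @max_pack Y YX.
  by exists (reverse z); exists 0; rewrite translate0.
have rzper k : reverse z (k + p%:Z) = reverse z k.
  by rewrite /reverse -[LHS]zper; congr z; lia.
have rz : pack r (reverse z).
  have rzm (d : nat) k : reverse z (k + (d * p)%N%:Z) = reverse z k.
    elim: d => [|d IH]; first by rewrite mul0n addr0.
    by rewrite -[RHS]IH -[RHS]rzper; congr (reverse z _); lia.
  have hk : `|c|%N%:Z <= (`|c| * p)%N%:Z by nia.
  have := pack_shiftn `|((`|c|%N * p)%N%:Z - c)%R|%N pg.
  rewrite gE translateD.
  suff -> : translate (`|((`|c| * p)%N%:Z - c)%R|%N%:Z + c) (reverse z) = reverse z by [].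
  apply/funext => k; rewrite -[RHS](rzm `|c|%N) /translate; congr (reverse z _); lia.
have := pack_add rz (pack1 (X_rev Xy)) yz (nesym yz0).
by move=> /(rmax _ _ (ex_intro _ 1 erefl)); lia.
Qed.

(** Determinism in both directions propagates agreement from a window to the
    whole line; the past of [q] is the future of its reversal. *)
Lemma periodic_isolated q : X q -> periodic q ->
  exists n, forall y, X y -> agree n y q -> y = q.
Proof.
move=> Xq qper.
have [n hn] := periodic_right_det Xq qper.
have rqper : periodic (reverse q).
  case: qper => p p0 h; exists p => // k.
  by rewrite /reverse -[LHS]h; congr q; lia.
have [n' hn'] := periodic_right_det (X_rev Xq) rqper.
exists (n + n')%N => y Xy h.
suff H d : agree (n + n' + d) y q.
  by apply/funext => k; apply: (H `|k|%N); lia.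
elim: d => [|d IH]; first by rewrite addn0.
move=> k kd; have [kd'|kd'] := lerP `|k| (n + n' + d)%N%:Z; first exact: IH.
have [k0|k0] := lerP 0 k.
  have := hn (translate k y) k (X_shift k Xy).
  rewrite /translate add0r; apply => r r1 r2; apply: IH; lia.
have := hn' (reverse (translate k y)) (- k) (X_rev (X_shift k Xy)).
rewrite /translate /reverse oppr0 add0r opprK; apply => r r1 r2.
by rewrite opprD opprK; apply: IH; lia.
Qed.

(** A code is a translate of each isolated code of its limit set. *)
Lemma codes_periodic x : X x -> periodic x.
Proof.
move=> Xx.
have [q oq qper] := omega_has_periodic Xx.
have Xq := omega_sub X_closed X_shift Xx oq.
have [n hn] := periodic_isolated Xq qper.
have [k _ /(hn _ (X_shift _ Xx)) e] := oq n 0%N.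
case: qper => p p0 h; exists p => // i.
have xE j : x j = q (j - k%:Z) by rewrite -e /translate subrK.
by rewrite !xE addrAC h.
Qed.

(** Otherwise distinct codes with a common long window would accumulate at a
    periodic code, contrary to its isolation. *)
Theorem codes_finite : finite_set X.
Proof.
have [n hn] : exists n, forall f g, X f -> X g -> agree n f g -> f = g.
  apply: contrapT => /forallNP no.
  have /choice[fg fgP] : forall n : nat, exists fg : (int -> I) * (int -> I),
      [/\ X fg.1, X fg.2, agree n fg.1 fg.2 & fg.1 <> fg.2].
    move=> n; have /existsNP[f] := no n.
    move=> /existsNP[g] /not_implyP[Xf] /not_implyP[Xg] /not_implyP[e ne].
    by exists (f, g).
  have [||||f [g [Xf Xg lim]]] :=
      @seq_limit2 I X X (fun j => (fg j).1) (fun j => (fg j).2) => //.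
  - by move=> j; have [] := fgP j.
  - by move=> j; have [] := fgP j.
  have fg_eq : f = g.
    apply/funext => k; have [j [kj jf jg]] := lim `|k|%N `|k|%N.
    by have [_ _ e _] := fgP j; rewrite -jf -?jg ?e //; lia.
  have [N hN] := periodic_isolated Xf (codes_periodic Xf).
  have [j [_ jf jg]] := lim N 0%N; have [Xj Xj' _] := fgP j.
  by apply; rewrite (hN _ Xj) // (hN _ Xj') // fg_eq.
have [X0|/set0P[f0 Xf0]] := eqVneq X set0; first by rewrite X0.
pose word f := [ffun r : 'I_(n + n).+1 => f (r%:Z - n%:Z)].
pose F w := xget f0 [set f | X f /\ word f = w].
apply: (@sub_finite_set _ _ (F @` setT)); last exact/finite_image/finite_finset.
move=> f Xf; exists (word f) => //.
rewrite /F; case: xgetP => [g _ [Xg e]|/(_ f)]; last by case.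
apply: hn => // k kn; have kl : (`|(k + n%:Z)%R| < (n + n).+1)%N by lia.
have := congr1 (fun G : {ffun 'I_(n + n).+1 -> I} => G (Ordinal kl)) e; rewrite !ffunE /=.
by have -> : `|(k + n%:Z)%R|%N%:Z - n%:Z = k by lia.
Qed.

End Packing.
End Symbolic.

(** * Euclidean preliminaries *)

Lemma sqr_leP (F : realType) (x B : F) : 0 <= B ->
  (x ^+ 2 <= B ^+ 2) = (- B <= x <= B).
Proof. by move=> B0; rewrite -ler_norml -real_normK ?num_real // ler_sqr ?nnegrE. Qed.

Section Dot.
Context {R : realType} {n : nat}.
Implicit Types u v w a : 'rV[R]_n.

Lemma dotDl u v w : dot (u + v) w = dot u w + dot v w.
Proof. by have := dotDZ 1 1 u v w; rewrite !scale1r !mul1r. Qed.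

Lemma dotZl (c : R) u w : dot (c *: u) w = c * dot u w.
Proof. by have := dotDZ c 0 u u w; rewrite scale0r mul0r !addr0. Qed.

Lemma dotNl u w : dot (- u) w = - dot u w.
Proof. by rewrite -scaleN1r dotZl mulN1r. Qed.

Lemma dotBl u v w : dot (u - v) w = dot u w - dot v w.
Proof. by rewrite dotDl dotNl. Qed.

Lemma dotDr u v w : dot w (u + v) = dot w u + dot w v.
Proof. by rewrite dotC dotDl !(dotC w). Qed.

Lemma dotZr (c : R) u w : dot w (c *: u) = c * dot w u.
Proof. by rewrite dotC dotZl (dotC w). Qed.

Lemma dotNr u w : dot w (- u) = - dot w u.
Proof. by rewrite dotC dotNl (dotC w). Qed.

Lemma dotBr u v w : dot w (u - v) = dot w u - dot w v.
Proof. by rewrite dotDr dotNr. Qed.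

Definition dotE := (dotBl, dotBr, dotDl, dotDr, dotZl, dotZr, dotNl, dotNr).

Lemma dot_eq0 u : dot u u = 0 -> u = 0.
Proof.
move=> /eqP; rewrite psumr_eq0 => [/allP h|i _]; last by rewrite -expr2 sqr_ge0.
apply/rowP => i; have := h i; rewrite mem_index_enum => /(_ isT).
by rewrite mulf_eq0 orbb mxE => /eqP.
Qed.

Lemma bessel u v : dot u u = 1 -> dot u v ^+ 2 <= dot v v.
Proof.
move=> u1; have := dotuu_ge0 (v - dot u v *: u).
by rewrite !dotE u1 (dotC v u) expr2; lra.
Qed.

Lemma dot_le_sum u v : dot u v <= (dot u u + dot v v) / 2.
Proof. by have := dotuu_ge0 (u - v); rewrite !dotE (dotC v u); lra. Qed.

Lemma dot_ge_unit u v : dot u u = 1 -> dot v v = 1 -> -1 <= dot u v.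
Proof.
by move=> u1 v1; have := dotuu_ge0 (u + v); rewrite !dotE u1 v1 (dotC v u); lra.
Qed.

Definition reflection a v := v - (2 * dot a v) *: a.

Lemma reflection_id a v : dot a v = 0 -> reflection a v = v.
Proof. by move=> h; rewrite /reflection h mulr0 scale0r subr0. Qed.

Lemma reflectionB a u v : reflection a (u - v) = reflection a u - reflection a v.
Proof. by rewrite /reflection !dotE; apply/rowP=> i; rewrite !mxE; ring. Qed.

Lemma reflectionZ a c v : reflection a (c *: v) = c *: reflection a v.
Proof. by rewrite /reflection !dotE; apply/rowP=> i; rewrite !mxE; ring. Qed.

Lemma reflectionN a v : reflection a (- v) = - reflection a v.
Proof. by rewrite /reflection !dotE; apply/rowP=> i; rewrite !mxE; ring. Qed.

Lemma dot_reflection_comm a u v : dot (reflection a u) v = dot u (reflection a v).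
Proof. by rewrite /reflection !dotE (dotC u a); ring. Qed.

Lemma dot_normal_reflection a v : dot a a = 1 -> dot a (reflection a v) = - dot a v.
Proof. by move=> a1; rewrite /reflection !dotE a1; ring. Qed.

Lemma reflectionK a : dot a a = 1 -> involutive (reflection a).
Proof.
move=> a1 v; rewrite {1}/reflection dot_normal_reflection // mulrN scaleNr opprK.
by rewrite /reflection subrK.
Qed.

Lemma dot_reflection a u v : dot a a = 1 ->
  dot (reflection a u) (reflection a v) = dot u v.
Proof. by move=> a1; rewrite dot_reflection_comm reflectionK. Qed.

(** For a unit vector [v], the squared length of the component of [u] orthogonal
    to [v]. *)
Definition perp_sq u v := dot u u - dot u v ^+ 2.

Lemma perp_sqE u v : dot v v = 1 ->
  perp_sq u v = dot (u - dot u v *: v) (u - dot u v *: v).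
Proof. by move=> v1; rewrite !dotE v1 (dotC v u) /perp_sq; ring. Qed.

(** Points of a ball that are [d] apart fall into distinct cells of a grid of
    mesh [d / (n + 1)]. *)
Lemma separated_bound (B d : R) : 0 < d -> exists K : nat, forall p (u : 'I_p -> 'rV[R]_n),
  (forall i, dot (u i) (u i) <= B ^+ 2) ->
  (forall i j, i != j -> d ^+ 2 <= dot (u i - u j) (u i - u j)) -> (p <= K)%N.
Proof.
move=> d0; wlog B0 : B / 0 <= B.
  move=> H; have [K hK] := H `|B| (normr_ge0 _); exists K => p u hu; apply: hK.
  by move=> i; rewrite -normrX ger0_norm ?sqr_ge0.
pose s := d / n.+1%:R; have s0 : 0 < s by rewrite divr_gt0.
pose N := (Num.truncn ((B + B) / s)).+1.
exists #|{: {ffun 'I_n -> 'I_N}}| => p u hu hd.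
have coord i c : 0 <= u i 0 c + B <= B + B.
  have : u i 0 c ^+ 2 <= B ^+ 2.
    apply: le_trans (hu i); rewrite /dot (bigD1 c) //= -expr2 lerDl.
    by apply: sumr_ge0 => e _; rewrite -expr2 sqr_ge0.
  by rewrite sqr_leP // => /andP[? ?]; lra.
have cellP i c : (Num.truncn ((u i 0 c + B) / s)%R < N)%N.
  have /andP[c0 c1] := coord i c.
  by rewrite ltnS; apply: le_truncn; rewrite ler_wpM2r // invr_ge0 ltW.
pose cell i := [ffun c => Ordinal (cellP i c)].
have /leq_card : injective cell; last by rewrite card_ord.
move=> i j e; apply/eqP; apply: contraT => ij; have := hd _ _ ij.
have lt c : (u i 0 c - u j 0 c) ^+ 2 <= s ^+ 2.
  have := congr1 (fun F : {ffun 'I_n -> 'I_N} => val (F c)) e; rewrite !ffunE /= => et.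
  have /andP[i0 _] := coord i c; have /andP[j0 _] := coord j c.
  have := truncn_itv (divr_ge0 i0 (ltW s0)).
  have := truncn_itv (divr_ge0 j0 (ltW s0)).
  rewrite et; set t := Num.truncn _; rewrite -natr1 !ler_pdivlMr // !ltr_pdivrMr //.
  move=> h1 h2; rewrite sqr_leP ?(ltW s0) //; lra.
have : dot (u i - u j) (u i - u j) <= \sum_(c < n) s ^+ 2.
  by apply: ler_sum => c _; rewrite !mxE -expr2 lt.
rewrite sumr_const card_ord => h1 h2.
have : s ^+ 2 *+ n < d ^+ 2; last by rewrite ltNge (le_trans h2 h1).
have dE : d = s * n.+1%:R by rewrite /s divfK // pnatr_eq0.
clearbody s; rewrite -mulr_natr dE exprMn ltr_pM2l ?exprn_gt0 // -natrX ltr_nat; nia.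
Qed.

End Dot.

Section Limit.
Context {R : realType} {n : nat}.
Variable U : set_system nat.
Hypothesis ultraU : UltraFilter U.

(** Convergence is stated by coordinates, in which the conditions that pass to the
    limit are polynomial. *)
Definition vlim (z : nat -> 'rV[R]_n) (l : 'rV[R]_n) :=
  forall c, z j 0 c @[j --> U] --> l 0 c.

Lemma ultra_limit (h : nat -> R) B : (forall j, - B <= h j <= B) ->
  exists l : R, h j @[j --> U] --> l.
Proof.
move=> hB; have pU : ProperFilter U  by exact: ultra_proper.
have [|l [_ cl]] := @segment_compact R (- B) B (h @ U) _.
  suff : U (h @^-1` `[- B, B]) by [].
  by apply: filterS filterT => j _; rewrite /= in_itv /=; exact: hB.
exists l => A Al; have [//|UA] := in_ultra_setVsetC (h @^-1` A) ultraU.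
have [z [nAz Az]] : (~` A) `&` A !=set0 by exact: cl.
by case: nAz.
Qed.

Lemma limit_ge0 (h : nat -> R) l : h j @[j --> U] --> l -> U [set j | 0 <= h j] -> 0 <= l.
Proof. by move=> hl h0; apply: (closed_cvg _ (@closed_ge R 0) h0) hl. Qed.

Lemma limit_eq0 (h : nat -> R) l : h j @[j --> U] --> l -> U [set j | h j = 0] -> l = 0.
Proof. by move=> hl h0; apply: (closed_cvg _ (@closed_eq R 0) h0) hl. Qed.

Lemma vlim_dot z z' l m : vlim z l -> vlim z' m -> dot (z j) (z' j) @[j --> U] --> dot l m.
Proof.
move=> zl z'm; apply: (cvg_big (@add_continuous R)) => i _.
exact: cvgM (zl i) (z'm i).
Qed.

Lemma vlim_cst l : vlim (fun=> l) l.
Proof. by move=> c; exact: cvg_cst. Qed.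
Arguments vlim_cst : clear implicits.

Lemma vlimB z z' l m : vlim z l -> vlim z' m -> vlim (fun j => z j - z' j) (l - m).
Proof.
move=> zl z'm c; rewrite !mxE; under eq_fun do rewrite !mxE.
exact: cvgB (zl c) (z'm c).
Qed.

Lemma vlim_exists z B : (forall j, dot (z j) (z j) <= B ^+ 2) -> exists l, vlim z l.
Proof.
move=> zB; have /choice[l hl] : forall c, exists l : R, z j 0 c @[j --> U] --> l.
  move=> c; apply: (@ultra_limit _ `|B|) => j; rewrite -sqr_leP // real_normK ?num_real //.
  apply: le_trans (zB j); rewrite /dot (bigD1 c) //= -expr2 lerDl.
  by apply: sumr_ge0 => e _; rewrite -expr2 sqr_ge0.
by exists (\row_c l c) => c; rewrite mxE.
Qed.

End Limit.

(** * Bounce sequences of billiard trajectories *)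

Section Bounce.
Context {R : realType} {n : nat} {J : finType}.
Variables (a : J -> 'rV[R]_n) (b : J -> R) (rho Mb : R).
Implicit Types (x v y w : int -> 'rV[R]_n) (f g : int -> J).

(** The bounce points [x k], the directions [v k] of flight from [x k] to
    [x (k + 1)], and the faces [f k] that are hit. Closed conditions only, so
    that limits of bounce sequences are bounce sequences: transversality of the
    bounces and positive flight lengths follow from [orbit_far] and [orbit_next]. *)
Record orbit x v f : Prop := Orbit {
  orbit_face : forall k, dot (a (f k)) (x k) = b (f k);
  orbit_far : forall k j, j != f k -> dot (a j) (x k) <= b j - rho;
  orbit_unit : forall k, dot (v k) (v k) = 1;
  orbit_reflect : forall k, v (k + 1) = reflection (a (f (k + 1))) (v k);
  orbit_step : forall k, exists2 l, 0 <= l & x (k + 1) = x k + l *: v k;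
  orbit_next : forall k, f (k + 1) != f k }.

Definition code_of f : Prop := exists x v, orbit x v f.

Hypothesis a_unit : forall j, dot (a j) (a j) = 1.
Hypothesis rho0 : 0 < rho.
Hypothesis bounded : forall z, (forall j, dot (a j) z <= b j) -> dot z z <= Mb ^+ 2.

Lemma orbit_in x v f k j : orbit x v f -> dot (a j) (x k) <= b j.
Proof.
move=> o; have [->|ne] := eqVneq j (f k); first by rewrite (orbit_face o).
by apply: le_trans (orbit_far o ne) _; rewrite gerBl ltW.
Qed.

Lemma orbit_bounded x v f k : orbit x v f -> dot (x k) (x k) <= Mb ^+ 2.
Proof. by move=> o; apply: bounded => j; exact: orbit_in o. Qed.

(** Leaving the face [f k] for another one means getting [rho] away from it. *)
Lemma orbit_flight x v f k : orbit x v f ->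
  dot (a (f k)) (v k) < 0 /\ exists2 l, rho <= l & x (k + 1) = x k + l *: v k.
Proof.
move=> o; have [l l0 xE] := orbit_step o k.
have fne : f k != f (k + 1) by rewrite eq_sym (orbit_next o).
have := orbit_far o fne; rewrite xE !dotE (orbit_face o) => h.
have := dot_ge_unit (a_unit (f k)) (orbit_unit o k) => h1.
have h0 := rho0; split; first by nra.
by exists l => //; nra.
Qed.

Lemma orbit_shift x v f c : orbit x v f ->
  orbit (fun k => x (k + c)) (fun k => v (k + c)) (translate c f).
Proof.
case=> p1 p2 p3 p4 p5 p6; split => k; rewrite /translate //; rewrite ?[k + 1 + c]addrAC //.
by move=> j /p2.
Qed.

Lemma orbit_rev x v f : orbit x v f ->
  orbit (fun k => x (- k)) (fun k => - v (- k - 1)) (reverse f).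
Proof.
move=> o; have [p1 p2 p3 p4 p5 p6] := o; split => k; rewrite /reverse //.
- by move=> j /p2.
- by rewrite !dotE opprK.
- have := p4 (- (k + 1) - 1); rewrite subrK => e.
  have -> : - k - 1 = - (k + 1) by lia.
  by rewrite reflectionN e reflectionK.
- have [l l0 e] := p5 (- k - 1); exists l => //.
  have -> : - (k + 1) = - k - 1 by lia.
  by move: e; rewrite subrK => ->; rewrite scalerN addrK.
- by have := p6 (- (k + 1)); rewrite opprD subrK eq_sym.
Qed.

Lemma code_shift f c : code_of f -> code_of (translate c f).
Proof.
move=> [x [v o]]; exists (fun k => x (k + c)), (fun k => v (k + c)).
exact: orbit_shift.
Qed.

Lemma code_rev f : code_of f -> code_of (reverse f).
Proof.
move=> [x [v o]]; exists (fun k => x (- k)), (fun k => - v (- k - 1)).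
exact: orbit_rev.
Qed.

(** * Two orbits with a common code *)

Section Pair.
Variables (x v y w : int -> 'rV[R]_n) (f g : int -> J).
Hypotheses (ox : orbit x v f) (oy : orbit y w g).

(** The reflection in the common face therefore fixes the difference of the
    positions. *)
Lemma pair_mirror k : f k = g k -> dot (a (f k)) (x k - y k) = 0.
Proof. by move=> e; rewrite dotBr (orbit_face ox) e (orbit_face oy) subrr. Qed.

Lemma pair_backward k : f (k + 1) = g (k + 1) -> v (k + 1) = w (k + 1) -> v k = w k.
Proof.
move=> ef; rewrite (orbit_reflect ox) (orbit_reflect oy) -ef.
move=> /(congr1 (reflection (a (f (k + 1))))).
by rewrite !reflectionK.
Qed.

Lemma pair_forward k : f (k + 1) = g (k + 1) -> v k = w k -> v (k + 1) = w (k + 1).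
Proof. by move=> ef ev; rewrite (orbit_reflect ox) (orbit_reflect oy) -ef ev. Qed.

Let h k := dot (x k - y k) (v k - w k).

(** A reflection leaves [h] unchanged, because it fixes the difference of the
    positions; the flights of lengths [l] and [l'] increase it by
    [(l + l') * |v - w|^2 / 2]. *)
Lemma pair_spread k : f (k + 1) = g (k + 1) ->
  h k + rho * dot (v k - w k) (v k - w k) <= h (k + 1).
Proof.
move=> ef; rewrite /h (orbit_reflect ox) (orbit_reflect oy) -ef -reflectionB.
rewrite -dot_reflection_comm reflection_id ?pair_mirror //.
have [_ [l rl ->]] := orbit_flight k ox; have [_ [l' rl' ->]] := orbit_flight k oy.
have d0 := dotuu_ge0 (v k - w k); move: d0.
rewrite !dotE (orbit_unit ox) (orbit_unit oy) !(dotC (w k)) => d0; nra.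
Qed.

(** If the directions differ, the two unfolded lines diverge linearly; but points
    of a bounded polyhedron are a bounded distance apart. *)
Lemma pair_parallel : (forall k, 0 <= k -> f k = g k) -> forall k, 0 <= k -> v k = w k.
Proof.
move=> e; suff v0 : v 0 = w 0.
  move=> k k0; have -> : k = `|k|%N%:Z by lia.
  elim: `|k|%N => [//|i IH]; have -> : i.+1%:Z = i%:Z + 1 by lia.
  by apply: pair_forward => //; apply: e; lia.
set d := dot (v 0 - w 0) (v 0 - w 0).
have dE (k : nat) : dot (v k%:Z - w k%:Z) (v k%:Z - w k%:Z) = d.
  elim: k => [//|k <-]; have -> : k.+1%:Z = k%:Z + 1 by lia.
  rewrite (orbit_reflect ox) (orbit_reflect oy) -e; last by lia.
  by rewrite -reflectionB dot_reflection.
have grow (k : nat) : h 0 + k%:R * (rho * d) <= h k%:Z.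
  elim: k => [|k IH]; first by rewrite mul0r addr0.
  have := @pair_spread k%:Z (e _ _); rewrite dE.
  have -> : k.+1%:Z = k%:Z + 1 by lia.
  by move=> /(_ ltac:(lia)); rewrite -natr1 mulrDl mul1r addrA; lra.
have hb k : - (2 * Mb ^+ 2 + 2) <= h k <= 2 * Mb ^+ 2 + 2.
  have xb := orbit_bounded k ox; have yb := orbit_bounded k oy.
  have xy := dotuu_ge0 (x k + y k); have vw := dotuu_ge0 (v k + w k).
  have h1 := dot_le_sum (x k - y k) (v k - w k).
  have h2 := dot_le_sum (- (x k - y k)) (v k - w k).
  move: xy vw h1 h2; rewrite /h !dotE !(dotC (w k)) (dotC (y k) (x k)).
  have := orbit_unit ox k; have := orbit_unit oy k; lra.
have d0 : 0 <= d := dotuu_ge0 _.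
have [d_gt0|d_le0] := ltrP 0 d.
  have rd : 0 < rho * d by rewrite mulr_gt0.
  have hb0 := hb 0.
  have Mb2 : 0 <= Mb ^+ 2 := sqr_ge0 _.
  have := archi_boundP (x := (4 * Mb ^+ 2 + 4) / (rho * d)).
  rewrite divr_ge0 ?(ltW rd) //; last by lra.
  move=> /(_ isT); set N := Num.Def.archi_bound _; rewrite ltr_pdivrMr //.
  move: (grow N) (hb N%:Z) hb0 Mb2; move: (h 0) (h N%:Z) (Mb ^+ 2) (_ * (rho * d)).
  by move=> h0 hN B c ?????; exfalso; lra.
apply: subr0_eq; apply: dot_eq0; apply: le_anti.
by rewrite -/d d_le0.
Qed.

Lemma pair_step k : v k = w k -> f (k + 1) = g (k + 1) ->
  exists s, [/\ x (k + 1) - y (k + 1) = x k - y k + s *: v k,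
    v (k + 1) = reflection (a (f (k + 1))) (v k) &
    reflection (a (f (k + 1))) (x (k + 1) - y (k + 1)) = x (k + 1) - y (k + 1)].
Proof.
move=> ev ef.
have [l _ xE] := orbit_step ox k; have [l' _ yE] := orbit_step oy k.
exists (l - l'); split; last exact/reflection_id/pair_mirror.
  by rewrite xE yE -ev; apply/rowP => i; rewrite !mxE; ring.
exact: orbit_reflect ox k.
Qed.

(** Unfolding is isometric, and moving along parallel lines does not change their
    distance. *)
Lemma pair_perp k : v k = w k -> f (k + 1) = g (k + 1) ->
  perp_sq (x (k + 1) - y (k + 1)) (v (k + 1)) = perp_sq (x k - y k) (v k).
Proof.
move=> ev ef; have [s [dE vE rE]] := pair_step ev ef.
rewrite /perp_sq vE -dot_reflection_comm rE dE !dotE (orbit_unit ox).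
by rewrite !(dotC (v k) (_ k)); ring.
Qed.

(** Going backwards in parallel, whichever of the two lines is ahead when it
    meets its own face leaves the other one at depth [rho] behind that face. *)
Lemma branching_perp k : v k = w k -> f k != g k ->
  rho ^+ 2 <= perp_sq (x k - y k) (v k).
Proof.
move=> ev ne; have r0 := rho0; have v1 := orbit_unit ox k; rewrite perp_sqE //.
have [fv _] := orbit_flight k ox; have [gv _] := orbit_flight k oy; rewrite -ev in gv.
have xg := orbit_far ox (k := k) (j := g k); rewrite eq_sym ne in xg.
have yf := orbit_far oy ne; have {}xg := xg isT.
have xf := orbit_face ox k; have yg := orbit_face oy k.
set D := x k - y k; set s := dot D (v k).
have [s0|s0] := lerP 0 s.
  apply: le_trans (bessel _ (a_unit (f k))).
  rewrite ler_sqr ?nnegrE ?(ltW r0) //.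
    by rewrite /D !dotE; nra.
  by rewrite /D !dotE; nra.
apply: le_trans (bessel _ (a_unit (g k))).
rewrite -[leRHS]sqrrN ler_sqr ?nnegrE ?(ltW r0) //; rewrite /D !dotE; nra.
Qed.

End Pair.

(** * Counting parallel orbits with a common future *)

(** Only the future of [f] is prescribed, so that pasts that merge add up. *)
Definition packing p f : Prop := exists (X V : 'I_p -> int -> 'rV[R]_n) (F : 'I_p -> int -> J),
  [/\ forall i, orbit (X i) (V i) (F i), forall i k, 0 <= k -> F i k = f k &
    forall i j, i != j -> rho ^+ 2 <= perp_sq (X i 0 - X j 0) (V i 0)].

Lemma packing1 f : code_of f -> packing 1 f.
Proof.
move=> [x [v o]]; exists (fun=> x), (fun=> v), (fun=> f); split => // i j.
by rewrite !ord1 eqxx.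
Qed.

(** The lines are parallel, and their traces on an orthogonal hyperplane are
    separated points of a bounded set. *)
Lemma packing_bound : exists M, forall p f, packing p f -> (p <= M)%N.
Proof.
have [K hK] := separated_bound (n := n) Mb rho0; exists K => -[//|p] f [X [V [F [ o FE sep]]]].
have VE i j : V i 0 = V j 0.
  by apply: (pair_parallel (o i) (o j)) => // k k0; rewrite !FE.
apply: (hK _ (fun i => X i 0 - dot (X i 0) (V i 0) *: V i 0)) => i.
  have := orbit_unit (o i) 0; have := orbit_bounded 0 (o i) => h v1.
  by rewrite -perp_sqE //; apply: le_trans h; rewrite gerBl sqr_ge0.
move=> j ij; have := sep _ _ ij; rewrite perp_sqE ?(orbit_unit (o i)) //.
rewrite (VE j i); congr (_ <= dot _ _); rewrite dotBl.
  by apply/rowP => c; rewrite !mxE; ring.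
by apply/rowP => c; rewrite !mxE; ring.
Qed.

Lemma parallel_past x v y w f g : orbit x v f -> orbit y w g ->
  (forall k, 1 <= k -> f k = g k) -> v 0 = w 0.
Proof.
move=> ox oy e; apply: (pair_backward ox oy); first exact: e.
apply: (pair_parallel (orbit_shift 1 ox) (orbit_shift 1 oy)) => // k k0.
by apply: e; lia.
Qed.

(** The two families are separated from each other where their pasts split. *)
Lemma packing_add p r f g : packing p f -> packing r g ->
  (forall k, 1 <= k -> f k = g k) -> f 0 <> g 0 -> packing (p + r) (translate 1 f).
Proof.
move=> [X [V [F [ o FE sep]]]] [Y [W [G [ o' GE sep']]]] e /eqP ne.
pose Z (i : 'I_(p + r)) := match fintype.split i with inl i => X i | inr i => Y i end.
pose U (i : 'I_(p + r)) := match fintype.split i with inl i => V i | inr i => W i end.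
pose H (i : 'I_(p + r)) := match fintype.split i with inl i => F i | inr i => G i end.
have oZ i : orbit (Z i) (U i) (H i) by rewrite /Z /U /H; case: fintype.split.
have HE i k : 1 <= k -> H i k = f k.
  by rewrite /H => k1; case: fintype.split => ?; rewrite ?FE ?GE ?e //; lia.
exists (fun i k => Z i (k + 1)), (fun i k => U i (k + 1)), (fun i => translate 1 (H i)).
split => [i|i k k0|i j ij]; first exact: orbit_shift.
  by apply: HE; lia.
have par k l : U k 0 = U l 0 by apply: (parallel_past (oZ k) (oZ l)) => c c1; rewrite !HE.
rewrite (pair_perp (oZ i) (oZ j)) ?HE //.
have := par i j; have := oZ i; have := oZ j.
have sij : fintype.split i = fintype.split j -> i = j by move=> h; rewrite -[i]splitK h splitK.
move: sij; rewrite /Z /U /H.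
case: (fintype.split i) => i'; case: (fintype.split j) => j' sij oj oi ev.
- by apply: sep; apply: contra ij => /eqP E; rewrite sij ?E.
- by apply: (branching_perp oi oj ev); rewrite FE // GE.
- by apply: (branching_perp oi oj ev); rewrite FE // GE // eq_sym.
- by apply: sep'; apply: contra ij => /eqP E; rewrite sij ?E.
Qed.

Lemma packing_shift p f : packing p f -> packing p (translate 1 f).
Proof.
move=> [X [V [F [ o FE sep]]]].
exists (fun i k => X i (k + 1)), (fun i k => V i (k + 1)), (fun i => translate 1 (F i)).
split => [i|i k k0|i j ij]; first exact: orbit_shift.
  by rewrite /translate FE //; lia.
have VE : V i 0 = V j 0 by apply: (pair_parallel (o i) (o j)) => // k k0; rewrite !FE.
by rewrite (pair_perp (o i) (o j)) ?sep // !FE //; lia.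
Qed.

Lemma orbit_limit U (x v : nat -> int -> 'rV[R]_n) (f : nat -> int -> J) :
  UltraFilter U -> (forall j, orbit (x j) (v j) (f j)) -> exists x' v' f', [/\ orbit x' v' f',
    forall k, vlim U (x ^~ k) (x' k), forall k, vlim U (v ^~ k) (v' k) &
    forall k, U [set j | f j k = f' k]].
Proof.
move=> ultraU o; have pU : ProperFilter U by exact: ultra_proper.
have /choice[x' hx] : forall k, exists l, vlim U (x ^~ k) l.
  by move=> k; apply: (vlim_exists ultraU (B := Mb)) => j; exact: orbit_bounded (o j).
have /choice[v' hv] : forall k, exists l, vlim U (v ^~ k) l.
  by move=> k; apply: (vlim_exists ultraU (B := 1)) => j; rewrite (orbit_unit (o j)) expr1n.
have /choice[f' hf] : forall k, exists i, U [set j | f j k = i].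
  by move=> k; exact: ultra_finite.
exists x', v', f'; split=> //.
have dots k i := vlim_dot ultraU (@vlim_cst R n U ultraU (a i)) (hx k).
have dvv k := vlim_dot ultraU (hv k) (hv k).
split => k.
- apply/subr0_eq.
  apply: (limit_eq0 ultraU (cvgB (dots k (f' k)) (cvg_cst (b (f' k))))).
  by apply: filterS (hf k) => j /= <-; rewrite /= (orbit_face (o j)) subrr.
- move=> j jne; rewrite -subr_ge0.
  apply: (limit_ge0 ultraU (cvgB (cvg_cst (b j - rho)) (dots k j))).
  apply: filterS (hf k) => i /= ie; rewrite /= subr_ge0.
  by apply: (orbit_far (o i)); rewrite ie.
- apply/subr0_eq; apply: (limit_eq0 ultraU (cvgB (dvv k) (cvg_cst (1 : R)))).
  by apply: filterS filterT => j _ /=; rewrite (orbit_unit (o j)) subrr.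
- apply/rowP => c; apply/subr0_eq; rewrite /reflection !mxE.
  have := vlim_dot ultraU (@vlim_cst R n U ultraU (a (f' (k + 1)))) (hv k).
  move=> /(cvgM (cvg_cst (2 : R)))/cvgM/(_ (cvg_cst (a (f' (k + 1)) 0 c))).
  move=> /(cvgB (hv k c))/(cvgB (hv (k + 1) c)) h; apply: (limit_eq0 ultraU h).
  apply: filterS (hf (k + 1)) => j /= <- /=.
  by rewrite (orbit_reflect (o j)) /reflection !mxE subrr.
- have d := vlim_dot ultraU (vlimB ultraU (hx (k + 1)) (hx k)) (hv k).
  exists (dot (x' (k + 1) - x' k) (v' k)).
    apply: (limit_ge0 ultraU d); apply: filterS filterT => j _ /=.
    have [l l0 ->] := orbit_step (o j) k.
    by rewrite addrC addKr dotZl (orbit_unit (o j)) mulr1.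
  apply/rowP => c; apply/subr0_eq; rewrite !mxE.
  apply: (limit_eq0 ultraU (cvgB (hx (k + 1) c) (cvgD (hx k c) (cvgM d (hv k c))))).
  apply: filterS filterT => j _.
  change (x j (k + 1) 0 c -
    (x j k 0 c + dot (x j (k + 1) - x j k) (v j k) * v j k 0 c) = 0).
  have [l l0 ->] := orbit_step (o j) k.
  by rewrite [in X in dot X _]addrC addKr dotZl (orbit_unit (o j)) mulr1 !mxE subrr.
- have [j [/= <- <-]] := filter_ex (filterI (hf k) (hf (k + 1))).
  exact: orbit_next (o j) k.
Qed.

Lemma code_closed : closed_codes code_of.
Proof.
move=> f hf; have [U [ultraU ge]] := free_ultrafilter.
have pU : ProperFilter U by exact: ultra_proper.
have /choice[xvf hx] : forall j : nat,
    exists xvf : (int -> 'rV[R]_n) * (int -> 'rV[R]_n) * (int -> J),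
    orbit xvf.1.1 xvf.1.2 xvf.2 /\ agree j xvf.2 f.
  by move=> j; have [g [x [v o]] gf] := hf j; exists (x, v, g).
have [x [v [g [ o _ _ hg]]]] := orbit_limit ultraU (fun j => (hx j).1).
suff -> : f = g by exists x, v.
apply/funext => k; have [j [/= <- kj]] := filter_ex (filterI (hg k) (ge `|k|%N)).
by rewrite (hx j).2 //; move: kj; lia.
Qed.

Lemma packing_closed p : closed_codes (packing p).
Proof.
move=> f hf; have [U [ultraU ge]] := free_ultrafilter.
have pU : ProperFilter U by exact: ultra_proper.
pose T := ('I_p -> int -> 'rV[R]_n)%type.
have /choice[q hq] : forall j : nat, exists q : T * T * ('I_p -> int -> J),
    [/\ forall i, orbit (q.1.1 i) (q.1.2 i) (q.2 i),
      forall i k, 0 <= k -> `|k| <= j%:Z -> q.2 i k = f k &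
      forall i i', i != i' -> rho ^+ 2 <= perp_sq (q.1.1 i 0 - q.1.1 i' 0) (q.1.2 i 0)].
  move=> j; have [g [X [V [F [ o FE sep]]]] gf] := hf j; exists (X, V, F); split => //.
  by move=> i k k0 kj; rewrite /= FE // gf.
have oq i j : orbit ((q j).1.1 i) ((q j).1.2 i) ((q j).2 i) by have [] := hq j.
have /choice[r hr] : forall i, exists r : (int -> 'rV[R]_n) * (int -> 'rV[R]_n) * (int -> J),
    [/\ orbit r.1.1 r.1.2 r.2, vlim U (fun j => (q j).1.1 i 0) (r.1.1 0),
      vlim U (fun j => (q j).1.2 i 0) (r.1.2 0) &
      forall k, U [set j | (q j).2 i k = r.2 k]].
  move=> i; have [x [v [g [ o hx hv hg]]]] := orbit_limit ultraU (oq i).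
  by exists (x, v, g).
exists (fun i => (r i).1.1), (fun i => (r i).1.2), (fun i => (r i).2); split => [i|i k k0|i i' ne].
- by have [] := hr i.
- have [_ _ _ h] := hr i; have [j [/= <- kj]] := filter_ex (filterI (h k) (ge `|k|%N)).
  by have [_ -> //] := hq j; move: kj; lia.
- have [_ xi vi _] := hr i; have [_ xi' _ _] := hr i'.
  have d := vlimB ultraU xi xi'; rewrite -subr_ge0 /perp_sq.
  have dv := vlim_dot ultraU d vi.
  rewrite (expr2 (dot _ _)).
  apply: (limit_ge0 ultraU
    (cvgB (cvgB (vlim_dot ultraU d d) (cvgM dv dv)) (cvg_cst (rho ^+ 2)))).
  apply: filterS filterT => j _ /=.
  have [_ _ sep] := hq j; have := sep _ _ ne.
  by rewrite -subr_ge0 /perp_sq (expr2 (dot _ _)).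
Qed.

Theorem bounce_codes_finite : finite_set code_of.
Proof.
have [M hM] := packing_bound.
exact: (codes_finite code_closed (fun f c => @code_shift f c) code_rev packing1 hM
  packing_shift packing_add packing_closed).
Qed.

Theorem bounce_codes_periodic f : code_of f -> periodic f.
Proof.
have [M hM] := packing_bound.
exact: (codes_periodic code_closed (fun f c => @code_shift f c) code_rev packing1 hM
  packing_shift packing_add packing_closed).
Qed.

End Bounce.

(** * Convex polyhedra given by unit normals *)

Section Normal.
Context {R : realType} {m : nat}.
Implicit Types (x y z : 'rV[R]_m.+1) (P : set 'rV[R]_m.+1).

Lemma unit_coord x i : dot x x = 1 -> `|x 0 i| <= 1.
Proof.
move=> x1; rewrite ler_norml -sqr_leP // expr1n -x1 /dot (bigD1 i) //= -expr2 lerDl.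
by apply: sumr_ge0 => e _; rewrite -expr2 sqr_ge0.
Qed.

Lemma dot_continuous a : continuous (dot (a : 'rV[R]_m.+1)).
Proof.
move=> x; have fx : Filter (nbhs x) by exact: nbhs_filter.
apply: (@cvg_big _ _ _ _ _ (@add_continuous R) _ (nbhs x) _
  (fun i y => a 0 i * y 0 i) (fun i => a 0 i * x 0 i)) => i _.
apply: (@cvgM _ _ (nbhs x) _ (fun=> a 0 i) (fun y : 'rV_m.+1 => y 0 i)).
  exact: cvg_cst.
exact: (@coord_continuous _ _ _ 0 i x).
Qed.

Lemma interior_unit P x a : interior P x -> dot a a = 1 -> exists2 t : R, 0 < t & P (x + t *: a).
Proof.
move=> /nbhs_ballP[e /= e0 he] a1; exists (e / 2); first by rewrite divr_gt0.
apply: he; split => // i j; rewrite /ball /= !mxE opprD addNKr normrN normrM !ord1.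
rewrite gtr0_norm ?divr_gt0 //; have := unit_coord j a1; have : 0 <= `|a 0 j| by [].
by nra.
Qed.

(** Vanishing and repeated constraints are discarded, so that two active
    constraints always come from two different hyperplanes. *)
Lemma polyhedron_normal_form P : convex_polyhedron P ->
  exists (k : nat) (a : 'I_k -> 'rV[R]_m.+1) (b : 'I_k -> R) (Mb : R),
  [/\ P = [set x | forall i, dot (a i) x <= b i], forall i, dot (a i) (a i) = 1,
    forall i j, a i = a j -> b i = b j -> i = j,
    forall x, (forall j, dot (a j) x <= b j) -> dot x x <= Mb ^+ 2 &
    exists x, forall i, dot (a i) x < b i].
Proof.
move=> [[k0 [a0 [b0 PE]]] bP [x0 ix0]].
have Px0 : P x0 by exact: interior_subset.
pose c i := (enorm (a0 i))^-1.
pose s := undup [seq (c i *: a0 i, c i * b0 i) | i <- enum 'I_k0 & a0 i != 0].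
have cpos i : a0 i != 0 -> 0 < c i /\ c i ^+ 2 * dot (a0 i) (a0 i) = 1.
  move=> ai; have d0 : 0 < dot (a0 i) (a0 i).
    by rewrite lt_def dotuu_ge0 andbT; apply: contra ai => /eqP/dot_eq0/eqP.
  rewrite /c /enorm invr_gt0 sqrtr_gt0 d0 exprVn sqr_sqrtr ?ltW //.
  by rewrite mulVf // gt_eqF.
have mem_s p : p \in s -> exists2 i, a0 i != 0 & p = (c i *: a0 i, c i * b0 i).
  by rewrite mem_undup => /mapP[i]; rewrite mem_filter => /andP[ai _] ->; exists i.
pose a (i : 'I_(size s)) := (nth (0, 0) s i).1.
pose b (i : 'I_(size s)) := (nth (0, 0) s i).2.
have sP i : exists2 i0, a0 i0 != 0 & (a i = c i0 *: a0 i0 /\ b i = c i0 * b0 i0).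
  have [i0 ai e] := mem_s _ (mem_nth (0, 0) (ltn_ord i)).
  by exists i0 => //; rewrite /a /b e.
have unit i : dot (a i) (a i) = 1.
  have [i0 ai [-> _]] := sP i; rewrite dotZl dotZr mulrA -expr2.
  by have [] := cpos _ ai.
have PE' : P = [set x | forall i, dot (a i) x <= b i].
  apply/seteqP; split => x Px.
    move=> i; have [i0 ai [-> ->]] := sP i; rewrite dotZl.
    by rewrite ler_pM2l; [move: Px; rewrite PE; exact | have [] := cpos _ ai].
  rewrite PE => i; have [ai|ai] := eqVneq (a0 i) 0.
    move: Px0; rewrite PE => /(_ i); rewrite ai.
    by rewrite !(_ : forall z, dot 0 z = 0) // => z; rewrite -(scale0r 0) dotZl mul0r.
  have ps : (c i *: a0 i, c i * b0 i) \in s.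
    by rewrite mem_undup; apply/mapP; exists i => //; rewrite mem_filter ai mem_enum.
  have is_ := ps; rewrite -index_mem in is_.
  have := Px (Ordinal is_); rewrite /a /b /= nth_index //= dotZl ler_pM2l //.
  by have [] := cpos _ ai.
have [M hM] : exists M, forall x, P x -> `|x| <= M 
  by have [M [_ hM]] := bP; exists (M + 1); apply: hM; rewrite ltrDl.
exists (size s), a, b, ((M + 1) * m.+1%:R); split => //.
- move=> i j ea eb; apply/val_inj/eqP; rewrite /=.
  have e : nth (0, 0) s i = nth (0, 0) s j by apply: injective_projections.
  by rewrite -(nth_uniq (0, 0) (ltn_ord i) (ltn_ord j) (undup_uniq _)) e.
- move=> x; have -> : (forall j, dot (a j) x <= b j) <-> P x by rewrite PE'.
  move=> /hM xM; have M0 : 0 <= M by exact: le_trans (normr_ge0 x) xM.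
  have xi i : x 0 i * x 0 i <= (M + 1) ^+ 2.
    have : ball (0 : 'rV[R]_m.+1) (M + 1) x.
      by rewrite mx_norm_ball /ball_ /= sub0r normrN (le_lt_trans xM) // ltrDl.
    move=> [_ /(_ 0 i)]; rewrite /ball /= mxE sub0r normrN => xi.
    by rewrite -expr2 sqr_leP ?addr_ge0 // -ler_norml ltW.
  apply: (@le_trans _ _ (\sum_(i < m.+1) (M + 1) ^+ 2)); first exact: ler_sum.
  rewrite sumr_const card_ord -[leLHS]mulr_natr exprMn.
  have mm : (m.+1%:R : R) <= m.+1%:R ^+ 2 by rewrite -natrX ler_nat; nia.
  by have := sqr_ge0 (M + 1); nra.
- exists x0 => i; have [t t0] := interior_unit ix0 (unit i).
  by rewrite PE' => /(_ i); rewrite !dotE unit; lra.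
Qed.

End Normal.

Definition halfspaces {R : realType} {m k : nat} (a : 'I_k -> 'rV[R]_m.+1) (b : 'I_k -> R) :
  set 'rV[R]_m.+1 := [set x | forall i, dot (a i) x <= b i].

Section Polyhedron.
Context {R : realType} {m k : nat}.
Variables (a : 'I_k -> 'rV[R]_m.+1) (b : 'I_k -> R) (Mb : R) (x0 : 'rV[R]_m.+1).
Implicit Types x y z : 'rV[R]_m.+1.
Local Notation P := (halfspaces a b).
Hypothesis a_unit : forall i, dot (a i) (a i) = 1.
Hypothesis ab_inj : forall i j, a i = a j -> b i = b j -> i = j.
Hypothesis bounded : forall z, (forall j, dot (a j) z <= b j) -> dot z z <= Mb ^+ 2.
Hypothesis x0_in : forall i, dot (a i) x0 < b i.

Lemma polyhedron_closed : closed P.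
Proof.
have -> : P = \bigcap_(i in [set: 'I_k]) (dot (a i) @^-1` [set r | r <= b i]).
  by apply/seteqP; split => [x Px i _|x Px i]; [exact: Px|exact: (Px i I)].
suff h i : setT i -> closed (dot (a i) @^-1` [set r | r <= b i]) by exact: (closed_bigI h).
move=> _.
have c : {in ~` (dot (a i) @^-1` [set r | r <= b i]), continuous (dot (a i))}.
  by move=> x _; exact: dot_continuous.
exact: (preimage_closed c (@closed_le R (b i))).
Qed.

Lemma interior_strict x : interior P x <-> forall i, dot (a i) x < b i.
Proof.
split=> [ix i|h].
  by have [t t0 /(_ i)] := interior_unit ix (a_unit i); rewrite !dotE a_unit; lra.
suff : \near x, forall i, dot (a i) x < b i.
  by apply: filterS => y hy i; exact: ltW.
have fx : Filter (nbhs x) by exact: nbhs_filter.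
apply: (@filter_forall _ _ (fun i y => dot (a i) y < b i) (nbhs x)) => i.
have /= := @dot_continuous R m (a i) x [set r | r < b i]; apply.
by apply: open_nbhs_nbhs; split; [exact: open_lt|exact: h].
Qed.

Lemma boundaryP x : boundary P x <-> P x /\ exists i, dot (a i) x = b i.
Proof.
rewrite /boundary -(closure_id P).1; last exact: polyhedron_closed.
split=> [[Px nix]|[Px [i e]]].
  split=> //; apply: contrapT => /forallNP h; apply: nix; apply/interior_strict => i.
  by rewrite lt_neqAle Px andbT; apply/eqP.
by split=> // /interior_strict/(_ i); rewrite e ltxx.
Qed.

(** A ray that starts inside leaves the bounded polyhedron through its boundary.
    Thus the infimum that defines the distance between the sheets is never an
    infimum over the empty set. *)
Lemma boundary_nonempty : boundary P !=set0.
Proof.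
pose e : 'rV[R]_m.+1 := delta_mx 0 0.
have e1 : dot e e = 1.
  rewrite /dot (bigD1 0) //= big1 ?addr0 => [|i /negbTE i0]; rewrite !mxE ?eqxx ?mulr1 //.
  by rewrite i0 andbF mulr0.
have [j j0] : exists j, 0 < dot (a j) e.
  apply: contrapT => /forallNP h.
  have in_ (t : R) : 0 <= t -> dot (x0 + t *: e) (x0 + t *: e) <= Mb ^+ 2.
    move=> t0; apply: bounded => i; rewrite !dotE.
    by have /negP := h i; rewrite -leNgt; have := x0_in i; nra.
  have M0 : 0 <= Mb ^+ 2 := sqr_ge0 _.
  have t0 : 0 <= Mb ^+ 2 + 2 + dot x0 x0 by have := dotuu_ge0 x0; lra.
  have := in_ _ t0; rewrite !dotE e1 (dotC e x0).
  have := dot_le_sum (- x0) e; rewrite !dotE e1.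
  by have := dotuu_ge0 x0; nra.
pose t i := (b i - dot (a i) x0) / dot (a i) e.
case: (@arg_minP _ _ _ j (fun i => 0 < dot (a i) e) t j0) => i i0 imin.
have tE l : 0 < dot (a l) e -> t l * dot (a l) e = b l - dot (a l) x0.
  by move=> l0; rewrite /t divfK // gt_eqF.
exists (x0 + t i *: e); apply/boundaryP; split; last first.
  by exists i; rewrite !dotE tE // subrKC.
move=> l; rewrite !dotE; have ti : 0 < t i by rewrite divr_gt0 // subr_gt0.
have [l0|l0] := ltrP 0 (dot (a l) e); last by have := x0_in l; nra.
by have := imin l l0; have := tE l l0; nra.
Qed.

(** Two active constraints cut out a face of codimension two: their normals are
    independent, opposite ones being excluded by the interior point. *)
Lemma two_faces_singular x i j : i != j -> P x -> dot (a i) x = b i ->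
  dot (a j) x = b j -> singular_points P x.
Proof.
move=> ij Px xi xj.
have free : row_free (col_mx (a i) (a j)).
  apply: inj_row_free => u; rewrite -[u]hsubmxK mul_row_col.
  set c := lsubmx u; set d := rsubmx u.
  rewrite [c]mx11_scalar [d]mx11_scalar !mul_scalar_mx.
  move: (c 0 0) (d 0 0) => {}c {}d cd.
  have d0 : d = 0.
    apply/eqP; apply: contraT => d0; pose t := - (c / d).
    have aE : a j = t *: a i.
      have : d^-1 *: (c *: a i + d *: a j) = 0 by rewrite cd scaler0.
      rewrite scalerDr !scalerA mulVf // scale1r => /eqP; rewrite addrC addr_eq0 => /eqP ->.
      by rewrite /t scaleNr mulrC.
    have /eqP : t ^+ 2 = 1 by rewrite -(a_unit j) aE dotZl dotZr a_unit mulr1.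
    have bE : b j = t * b i by rewrite -xj aE dotZl xi.
    rewrite sqrf_eq1 => /orP[/eqP t1|/eqP t1].
      by case/eqP: ij; apply: ab_inj; rewrite ?aE ?bE t1 ?scale1r ?mul1r.
    have := x0_in i; have := x0_in j; rewrite aE bE t1 dotZl; lra.
  have : c * dot (a i) (a i) = 0.
    rewrite -dotZl -[c *: a i](addrK (d *: a j)) cd d0 scale0r subr0.
    by rewrite -(scale0r (a i)) dotZl mul0r.
  rewrite a_unit mulr1 d0 => ->; rewrite -row_mx0 /=.
  by congr row_mx; apply/matrixP=> ? ?; rewrite !mxE mul0rn.
pose A := (col_mx (a i) (a j))^T.
have rA : \rank A = 2 by rewrite mxrank_tr; move/eqP: free.
exists (m.+1 - 2)%N; first by have := rank_leq_row A; rewrite rA; lia.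
exists (P `&` [set y | dot (a i + a j) y = b i + b j]); split.
- exists (a i + a j), (b i + b j); split => // y Py; rewrite dotDl lerD //; exact: Py.
- exists x, (kermx A); split; first by rewrite mxrank_ker rA.
  move=> y [Py /= yE]; apply/sub_kermxP.
  have yi : dot (a i) y = b i.
    by move: yE; rewrite dotDl; have := Py i; have := Py j; lra.
  have yj : dot (a j) y = b j by move: yE; rewrite dotDl; lra.
  rewrite /A tr_col_mx mul_mx_row.
  have dotmx u v : dot u v = 0 -> v *m u^T = 0.
    move=> uv; apply/matrixP => p q; rewrite !mxE !ord1; transitivity (dot u v) => //.
    by apply: eq_bigr => l _; rewrite !mxE mulrC.
  by rewrite !dotmx ?row_mx0 // dotBr ?yi ?yj ?xi ?xj subrr.
- by split=> //=; rewrite dotDl xi xj.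
Qed.

(** A limit of points with two almost active constraints has two active ones, and
    so it is singular. *)
Lemma uniform_gap (eps : R) : 0 < eps -> exists2 rho : R, 0 < rho & forall x, P x ->
  (forall z, singular_points P z -> P z -> eps <= edist x z) ->
  forall i j, i != j -> b i - rho < dot (a i) x -> dot (a j) x <= b j - rho.
Proof.
move=> eps0; apply: contrapT => no.
have /choice[q hq] : forall N : nat, exists q : 'rV[R]_m.+1 * 'I_k * 'I_k,
   [/\ P q.1.1, (forall z, singular_points P z -> P z -> eps <= edist q.1.1 z), q.1.2 != q.2,
     b q.1.2 - N.+1%:R^-1 < dot (a q.1.2) q.1.1 & b q.2 - N.+1%:R^-1 < dot (a q.2) q.1.1].
  move=> N; apply: contrapT => /forallNP h; apply: no; exists N.+1%:R^-1 => //.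
  move=> x Px xe i j ij bi; rewrite leNgt; apply/negP => bj.
  by apply: (h (x, i, j)).
have [U [ultraU ge]] := free_ultrafilter.
have pU : ProperFilter U by exact: ultra_proper.
have [x hx] : exists x, vlim U (fun N => (q N).1.1) x.
  by apply: (vlim_exists ultraU (B := Mb)) => N; apply: bounded; have [] := hq N.
have [i hi] := ultra_finite (fun N => (q N).1.2) ultraU.
have [j hj] := ultra_finite (fun N => (q N).2) ultraU.
have harm : (N.+1%:R^-1 : R) @[N --> U] --> (0 : R).
  move=> A A0; have [N _ hN] := @cvg_harmonic R A A0.
  exact: filterS hN (ge N).
have lim l := vlim_dot ultraU (@vlim_cst R _ U ultraU (a l)) hx.
have Px : P x.
  move=> l; rewrite -subr_ge0; apply: (limit_ge0 ultraU (cvgB (cvg_cst (b l)) (lim l))).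
  by apply: filterS filterT => N _ /=; rewrite subr_ge0; have [Pq _ _ _ _] := hq N; exact: Pq.
have active l : U [set N | b l - N.+1%:R^-1 < dot (a l) (q N).1.1] -> dot (a l) x = b l.
  move=> Ul; apply/eqP; rewrite eq_le Px -subr_ge0 -[X in 0 <= X]addr0 /=.
  apply: (limit_ge0 ultraU (cvgD (cvgB (lim l) (cvg_cst (b l))) harm)).
  apply: filterS Ul => N /= h.
  change (0 <= dot (a l) (q N).1.1 - b l + N.+1%:R^-1).
  by rewrite addrAC subr_ge0 -lerBlDr ltW.
have sing : singular_points P x.
  apply: (@two_faces_singular _ i j) => //.
  - have [N [/= <- <-]] := filter_ex (filterI hi hj); by have [] := hq N.
  - by apply: active; apply: filterS hi => N /= <-; have [] := hq N.
  - by apply: active; apply: filterS hj => N /= <-; have [] := hq N.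
have d := vlimB ultraU hx (@vlim_cst R _ U ultraU x).
have : 0 <= dot (x - x) (x - x) - eps ^+ 2.
  apply: (limit_ge0 ultraU (cvgB (vlim_dot ultraU d d) (cvg_cst (eps ^+ 2)))).
  apply: filterS filterT => N _ /=; rewrite subr_ge0.
  have [_ /(_ x sing Px) far _ _ _] := hq N.
  rewrite -[leRHS]sqr_sqrtr ?dotuu_ge0 // ler_sqr ?nnegrE ?sqrtr_ge0 //; exact: ltW.
rewrite subrr -(scale0r x) dotZl mul0r sub0r oppr_ge0 leNgt exprn_gt0 //.
Qed.

End Polyhedron.

(** * The double of a polyhedron *)

Section Norm.
Context {R : realType} {n : nat}.
Implicit Types x y z u v : 'rV[R]_n.

Lemma edist_le x y r : 0 <= r -> (edist x y <= r) = (dot (x - y) (x - y) <= r ^+ 2).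
Proof.
move=> r0; rewrite /Defs.edist /enorm -[in RHS](sqr_sqrtr (dotuu_ge0 (x - y))).
by rewrite ler_sqr ?nnegrE ?sqrtr_ge0.
Qed.

Lemma edist_eq x y r : 0 <= r -> edist x y = r <-> dot (x - y) (x - y) = r ^+ 2.
Proof.
move=> r0; rewrite /Defs.edist /enorm; split=> [<-|->]; first by rewrite sqr_sqrtr ?dotuu_ge0.
by rewrite sqrtr_sqr ger0_norm.
Qed.

Lemma edist_sqr x y : edist x y ^+ 2 = dot (x - y) (x - y).
Proof. by rewrite sqr_sqrtr ?dotuu_ge0. Qed.

Lemma edist0_eq x y : edist x y = 0 -> x = y.
Proof. by move=> e; apply/subr0_eq/dot_eq0; rewrite -edist_sqr e expr0n. Qed.

Lemma dot_edist_le a x y : dot a a = 1 -> `|dot a x - dot a y| <= edist x y.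
Proof.
move=> a1; rewrite -dotBr ler_norml -sqr_leP; last exact: Defs.edist_ge0.
by rewrite edist_sqr; exact: bessel.
Qed.

Lemma edist_line x y z c : z = x + c *: (y - x) -> edist x z = `|c| * edist x y.
Proof.
move=> ->; apply/edist_eq; first by rewrite mulr_ge0 ?Defs.edist_ge0.
rewrite exprMn edist_sqr real_normK ?num_real // opprD addNKr -scalerN opprB.
by rewrite dotZl dotZr; ring.
Qed.

End Norm.

Section Mirror.
Context {R : realType} {n : nat}.
Variables (a : 'rV[R]_n) (b : R).
Hypothesis a1 : dot a a = 1.
Implicit Types x y : 'rV[R]_n.

Definition mirror x := x - (2 * (dot a x - b)) *: a.

Lemma mirrorB x y : mirror x - mirror y = reflection a (x - y).
Proof. by rewrite /mirror /reflection !dotE; apply/rowP => i; rewrite !mxE; ring. Qed.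

Lemma mirror_id x : dot a x = b -> mirror x = x.
Proof. by rewrite /mirror => ->; rewrite subrr mulr0 scale0r subr0. Qed.

Lemma dot_mirror x : dot a (mirror x) - b = - (dot a x - b).
Proof. by rewrite /mirror !dotE a1; ring. Qed.

Lemma mirrorK : involutive mirror.
Proof. by move=> x; rewrite {1}/mirror dot_mirror /mirror; apply/rowP => i; rewrite !mxE; ring. Qed.

Lemma edist_mirror x y : edist (mirror x) (mirror y) = edist x y.
Proof. by rewrite /Defs.edist /enorm mirrorB dot_reflection. Qed.

Lemma edist_mirror_fix x y : dot a x = b -> edist x (mirror y) = edist x y.
Proof. by move=> h; rewrite -{1}(mirror_id h) edist_mirror. Qed.

End Mirror.

Section Double.
Context {R : realType} {m k : nat}.
Variables (a : 'I_k -> 'rV[R]_m.+1) (b : 'I_k -> R) (Mb : R) (x0 : 'rV[R]_m.+1).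
Implicit Types x y z q : 'rV[R]_m.+1.
Local Notation P := (halfspaces a b).
Hypothesis a_unit : forall i, dot (a i) (a i) = 1.
Hypothesis bounded : forall z, (forall j, dot (a j) z <= b j) -> dot z z <= Mb ^+ 2.
Hypothesis x0_in : forall i, dot (a i) x0 < b i.

Lemma x0_mem : x0 \in P.
Proof. by apply/mem_set => i; exact: ltW. Qed.

(** Total in [x], with a junk value outside the polyhedron, so that points of the
    double are written without membership proofs. *)
Definition mk x (s : bool) : pdouble P :=
  \pi_(pdouble P)%qT (insubd (exist (fun x => x \in P) x0 x0_mem) x, s).

Lemma val_insub x : P x -> \val (insubd (exist (fun x => x \in P) x0 x0_mem) x) = x.
Proof. by move=> Px; rewrite insubdK //; exact: mem_set. Qed.

Lemma mk_surj (p : pdouble P) : exists x s, P x /\ p = mk x s.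
Proof.
case: (repr p) (reprK p) => [[x xP] s] <-; exists x, s; split; first exact: set_mem.
rewrite /mk; suff -> : insubd (exist (fun x => x \in P) x0 x0_mem) x = exist _ x xP by [].
by apply/val_inj; rewrite /= val_insub //; exact: set_mem.
Qed.

Definition through x y := inf [set edist x z + edist z y | z in boundary P].

Lemma mk_dist x y s s' : P x -> P y ->
  ddist (mk x s) (mk y s') = if s == s' then edist x y else through x y.
Proof. by move=> Px Py; rewrite ddist_pi /sheets_dist /= !val_insub. Qed.

Lemma mk_eq x y s s' : P x -> P y ->
  mk x s = mk y s' <-> x = y /\ (s = s' \/ boundary P x).
Proof.
move=> Px Py; split.
  move=> /eqmodP /= /andP[/= /eqP e h].
  have exy : x = y by rewrite -(val_insub Px) -(val_insub Py) e.
  split=> //; move: h => /orP[/eqP ->|]; first by left.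
  by rewrite val_insub // => /set_mem; right.
move=> [<- h]; apply/eqmodP; rewrite /= /Defs.glue /= eqxx /= val_insub //.
by case: h => [->|h]; rewrite ?eqxx // mem_set ?orbT.
Qed.

Lemma mk_sheet x s s' : boundary P x -> P x -> mk x s = mk x s'.
Proof. by move=> bx Px; apply/mk_eq => //; split=> //; right. Qed.

Lemma singular_mk x s : P x -> singular_points P x -> singular_set (mk x s).
Proof.
move=> Px sx; exists (insubd (exist (fun x => x \in P) x0 x0_mem) x, s) => //=.
by rewrite val_insub.
Qed.

Lemma avoid_far eps x s : P x -> ~ singular_nbhd eps (mk x s) ->
  forall z, singular_points P z -> P z -> eps <= edist x z.
Proof.
move=> Px h z sz Pz; rewrite leNgt; apply/negP => lt; apply: h.
by exists (mk z s); [exact: singular_mk | rewrite mk_dist // eqxx].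
Qed.

Lemma through_ge x y r : (forall z, boundary P z -> r <= edist x z + edist z y) -> r <= through x y.
Proof.
move=> h; apply: lb_le_inf.
  have [z bz] := boundary_nonempty a_unit bounded x0_in.
  by exists (edist x z + edist z y), z.
by move=> _ [z bz <-]; exact: h.
Qed.

Lemma through_le x y z : boundary P z -> through x y <= edist x z + edist z y.
Proof.
move=> bz; apply: ge_inf; last by exists z.
by exists 0 => _ [w _ <-]; rewrite addr_ge0 ?Defs.edist_ge0.
Qed.

(** Reaching the other sheet means passing through the boundary. *)
Lemma near_interior q x s s' r : P q -> P x -> (forall j, dot (a j) q <= b j - r) ->
  ddist (mk q s) (mk x s') < r -> s' = s /\ edist q x < r.
Proof.
move=> Pq Px hq; rewrite mk_dist //; case: eqVneq => [<- //|_].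
rewrite ltNge => /negP[]; apply: through_ge => z /(boundaryP b a_unit)[_ [j zj]].
have := dot_edist_le z q (a_unit j); rewrite zj ler_norml Defs.edistC => /andP[_].
by have := hq j; have := Defs.edist_ge0 z x; lra.
Qed.

(** Unfolding across a face: near a point of a single face, the second sheet is
    seen as its mirror image, because the shortest path crosses that face. *)
Lemma through_mirror i q rho x y : dot (a i) q = b i -> 0 < rho ->
  (forall j, j != i -> dot (a j) q <= b j - rho) -> P x -> P y ->
  edist q x <= rho / 4 -> edist q y <= rho / 4 ->
  through x y = edist x (mirror (a i) (b i) y).
Proof.
move=> qi r0 far Px Py qx qy; move yE: (mirror (a i) (b i) y) => y'.
have qy' : edist q y' <= rho / 4 by rewrite -yE (edist_mirror_fix (a_unit i) _ qi).
apply/eqP; rewrite eq_le; apply/andP; split; last first.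
  apply: through_ge => z /(boundaryP b a_unit)[_ [j zj]].
  have [ji|ji] := eqVneq j i.
    by rewrite -(edist_mirror_fix (a_unit i) y (b := b i)) ?yE ?Defs.edist_triangle // -ji.
  have := dot_edist_le z q (a_unit j); rewrite zj ler_norml => /andP[_ zq].
  have := Defs.edist_triangle z x q; have := Defs.edist_triangle z y q.
  have := Defs.edist_triangle x q y'.
  rewrite (Defs.edistC x q) (Defs.edistC y q) (Defs.edistC x z).
  by have := far j ji; lra.
pose p := dot (a i) x - b i; pose r := dot (a i) y - b i.
have p0 : p <= 0 by rewrite subr_le0; exact: Px.
have r0' : r <= 0 by rewrite subr_le0; exact: Py.
(* The face divides the segment from [x] to the mirror image of [y] in the ratio
   of the depths; when both depths vanish, [t] is [0] and [z] is [x]. *)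
pose t := p / (p + r).
have [t0 [t1 tE]] : 0 <= t /\ t <= 1 /\ t * (p + r) = p.
  have [pr|pr] := eqVneq (p + r) 0.
    by rewrite /t pr invr0 mulr0 mul0r; repeat split => //; lra.
  have {}pr : p + r < 0 by rewrite lt_neqAle pr; lra.
  by rewrite /t divfK ?lt_eqF // ler_ndivrMr // ler_ndivlMr // mul0r mul1r; repeat split; lra.
pose z := x + t *: (y' - x).
have zi : dot (a i) z = b i.
  rewrite /z !dotE; have := dot_mirror (b i) (a_unit i) y; rewrite yE -/r => ry.
  have -> : dot (a i) y' = b i - r by lra.
  have -> : dot (a i) x = b i + p by rewrite /p; lra.
  by move: tE; nra.
have xz : edist x z = t * edist x y' by rewrite (edist_line (c := t) (y := y')) // ger0_norm.
have zy' : edist z y' = (1 - t) * edist x y'.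
  rewrite Defs.edistC (Defs.edistC x) (@edist_line _ _ _ x _ (1 - t)) ?ger0_norm ?subr_ge0 //.
  by apply/rowP => l; rewrite !mxE; ring.
have bz : boundary P z.
  apply/(boundaryP b a_unit); split; last by exists i.
  move=> j; have [-> //|ji] := eqVneq j i; first by rewrite zi.
  have xy' : edist x y' <= rho / 2.
    by have := Defs.edist_triangle x q y'; rewrite (Defs.edistC x q); lra.
  have zq : edist z q <= rho.
    have := Defs.edist_triangle z x q; rewrite (Defs.edistC z x) xz (Defs.edistC x q).
    by have := Defs.edist_ge0 x y'; nra.
  have := dot_edist_le z q (a_unit j); rewrite ler_norml => /andP[_].
  by have := far j ji; lra.
apply: le_trans (through_le _ _ bz) _.
by rewrite -(edist_mirror_fix (a_unit i) y zi) yE xz zy'; lra.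
Qed.

Definition chart i x (s : bool) := if s then mirror (a i) (b i) x else x.

Lemma chart_dist i q rho x y s s' : dot (a i) q = b i -> 0 < rho ->
  (forall j, j != i -> dot (a j) q <= b j - rho) -> P x -> P y ->
  edist q x <= rho / 4 -> edist q y <= rho / 4 ->
  ddist (mk x s) (mk y s') = edist (chart i x s) (chart i y s').
Proof.
move=> qi r0 far Px Py qx qy; rewrite mk_dist //.
have [<-|ne] := eqVneq s s'; first by case: s; rewrite /= ?edist_mirror.
rewrite (through_mirror qi r0 far) //; case: s s' ne => [] [] //= _.
by rewrite -[RHS](edist_mirror (b i) (a_unit i)) mirrorK.
Qed.

End Double.

(** * From geodesics of the double to bounce sequences *)

(** The equality case of the triangle inequality, by polarization. *)
Lemma aligned {R : realType} {n : nat} (u w : 'rV[R]_n) (d h : R) : h != 0 ->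
  dot w w = h ^+ 2 -> dot u u = d ^+ 2 -> dot (u - w) (u - w) = (d - h) ^+ 2 ->
  u = d *: (h^-1 *: w).
Proof.
move=> h0 ww uu; rewrite !dotE ww uu (dotC w u) => uw.
apply: subr0_eq; apply: dot_eq0; rewrite scalerA !dotE ww uu (dotC w u).
have -> : dot u w = d * h by lra.
by field.
Qed.

Lemma isometry_affine {R : realType} {n : nat} (f : R -> 'rV[R]_n) (t0 r : R) : 0 < r ->
  (forall s s', `|s - t0| < r -> `|s' - t0| < r -> edist (f s) (f s') = `|s - s'|) ->
  exists2 v, dot v v = 1 & forall s, `|s - t0| < r -> f s = f t0 + (s - t0) *: v.
Proof.
move=> r0 iso; have h0 : 0 < r / 2 by rewrite divr_gt0.
have n0 : `|t0 - t0| < r by rewrite subrr normr0.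
have nh : `|t0 + r / 2 - t0| < r by rewrite addrC addKr gtr0_norm //; lra.
have sq s s' : `|s - t0| < r -> `|s' - t0| < r ->
    dot (f s - f s') (f s - f s') = (s - s') ^+ 2.
  by move=> hs hs'; rewrite -edist_sqr iso // real_normK ?num_real.
have ww := sq _ _ nh n0; rewrite [X in X ^+ 2]addrC addKr in ww.
exists ((r / 2)^-1 *: (f (t0 + r / 2) - f t0)).
  by rewrite dotZl dotZr ww; field; rewrite gt_eqF.
move=> s hs; apply/eqP; rewrite addrC -subr_eq; apply/eqP.
apply: aligned ww _ _; rewrite ?gt_eqF ?sq // opprB addrA subrK sq //.
by congr (_ ^+ 2); ring.
Qed.

Lemma two_sided_chain (T : Type) (S : T -> Prop) (L : T -> T -> Prop) (z0 : T) : S z0 ->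
  (forall z, S z -> exists2 z', S z' & L z z') -> (forall z, S z -> exists2 z', S z' & L z' z) ->
  exists c : int -> T, forall k, S (c k) /\ L (c k) (c (k + 1)).
Proof.
move=> Sz0 next prev; pose U := {z | S z}; pose w0 : U := exist S z0 Sz0.
have /choice[F hF] : forall z : U, exists z' : U, L (sval z) (sval z').
  by move=> [z Sz]; have [z' Sz' Lz] := next z Sz; exists (exist S z' Sz').
have /choice[G hG] : forall z : U, exists z' : U, L (sval z') (sval z).
  by move=> [z Sz]; have [z' Sz' Lz] := prev z Sz; exists (exist S z' Sz').
pose c (k : int) : U := match k with Posz i => iter i F w0 | Negz i => iter i.+1 G w0 end.
exists (fun k => sval (c k)) => k; split; first exact: svalP (c k).
case: k => [i|[|i]].
- by have -> : Posz i + 1 = Posz i.+1 by lia.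
- have -> : Negz 0 + 1 = Posz 0 by lia.
  exact: hG.
- have -> : Negz i.+1 + 1 = Negz i by lia.
  exact: hG.
Qed.

Section Geodesics.
Context {R : realType} {m k : nat}.
Variables (a : 'I_k -> 'rV[R]_m.+1) (b : 'I_k -> R) (Mb rho : R) (x0 : 'rV[R]_m.+1).
Implicit Types x y z v w : 'rV[R]_m.+1.
Local Notation P := (halfspaces a b).
Hypothesis a_unit : forall i, dot (a i) (a i) = 1.
Hypothesis bounded : forall z, (forall j, dot (a j) z <= b j) -> dot z z <= Mb ^+ 2.
Hypothesis x0_in : forall i, dot (a i) x0 < b i.
Hypothesis rho0 : 0 < rho.
Implicit Type gamma : R -> pdouble P.
Local Notation mk := (mk x0_in).

(** The second condition replaces the avoidance of the singular set: whatever is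
    closer than [rho] to one face is at least [rho] away from all the others. *)
Definition trajectory gamma : Prop :=
  (forall t, exists2 r, 0 < r & forall s s', `|s - t| < r -> `|s' - t| < r ->
     ddist (gamma s) (gamma s') = `|s - s'|) /\
  (forall t x s, P x -> gamma t = mk x s -> forall i j, i != j ->
     b i - rho < dot (a i) x -> dot (a j) x <= b j - rho).

Definition flies gamma t0 x v s t : Prop :=
  P (x + (t - t0) *: v) /\ gamma t = mk (x + (t - t0) *: v) s.

(** [vm] and [sm] are the direction and the sheet before [t0], [vp] and [sp] those
    after [t0]. *)
Definition germ gamma t0 x vm sm vp sp : Prop := exists2 d, 0 < d &
  (forall t, t0 <= t -> t < t0 + d -> flies gamma t0 x vp sp t) /\
  (forall t, t0 - d < t -> t <= t0 -> flies gamma t0 x vm sm t).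

Definition bounce gamma t0 x v s i : Prop :=
  [/\ dot (a i) x = b i, dot v v = 1, dot (a i) v < 0 &
    germ gamma t0 x (reflection (a i) v) (~~ s) v s].

Lemma flies_start gamma t0 x v s : flies gamma t0 x v s t0 -> P x /\ gamma t0 = mk x s.
Proof. by rewrite /flies subrr scale0r addr0. Qed.

Lemma far_from_other gamma t x s i j : trajectory gamma -> P x -> gamma t = mk x s ->
  dot (a i) x = b i -> j != i -> dot (a j) x <= b j - rho.
Proof.
move=> [_ G] Px e xi ji; apply: (G t x s Px e i) => //; first by rewrite eq_sym.
by rewrite xi gtrBl.
Qed.

Lemma interior_gap x : (forall i, dot (a i) x < b i) ->
  exists2 r, 0 < r & forall i, dot (a i) x <= b i - r.
Proof.
move=> h; exists (\big[Order.min/1]_i (b i - dot (a i) x)).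
  by apply: lt_bigmin => // i _; rewrite subr_gt0.
by move=> i; rewrite lerBrDl -lerBrDr; exact: (bigmin_le _ _ (fun i => b i - dot (a i) x)).
Qed.

(** In a chart the geodesic is a straight line. Either it stays on one sheet,
    possibly inside a face, or it crosses a face; in that case the chart of the
    second sheet is a mirror image, which gives the law of reflection. *)
Lemma local_structure gamma t0 : trajectory gamma ->
  (exists x v s, dot v v = 1 /\ germ gamma t0 x v s v s) \/
  (exists x v s i, bounce gamma t0 x v s i).
Proof.
move=> tr; have [G _] := tr; have [r r0 iso] := G t0.
have [x [s [Px ex]]] := mk_surj x0_in (gamma t0).
have n0 : `|t0 - t0| = 0 by rewrite subrr normr0.
have [[i xi]|int] := pselect (exists i, dot (a i) x = b i); last first.
  have [|r' r'0 gap] := @interior_gap x.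
    move=> i; rewrite lt_neqAle Px andbT; apply/eqP => e; apply: int; by exists i.
  pose d := Num.min r r'; have d0 : 0 < d by rewrite lt_min r0.
  have dr t : `|t - t0| < d -> `|t - t0| < r by rewrite lt_min => /andP[].
  have dr' t : `|t - t0| < d -> `|t - t0| < r' by rewrite lt_min => /andP[].
  have /choice[f hf] : forall t, exists y, `|t - t0| < d -> P y /\ gamma t = mk y s.
    move=> t; have [y [s' [Py ey]]] := mk_surj x0_in (gamma t).
    exists y => td; split=> //; rewrite ey.
    have /(near_interior a_unit bounded Px Py gap)[-> //] : ddist (mk x s) (mk y s') < r'.
    by rewrite -ex -ey iso ?n0 ?dr // distrC dr'.
  have [v v1 fE] : exists2 v, dot v v = 1 & forall t, `|t - t0| < d -> f t = f t0 + (t - t0) *: v.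
    apply: (isometry_affine d0) => t t' td t'd.
    have [Pf ef] := hf t td; have [Pf' ef'] := hf t' t'd.
    by rewrite -(iso t t') ?dr // ef ef' mk_dist // eqxx.
  have f0 : f t0 = x.
    have [|Pf ef] := hf t0; first by rewrite n0.
    by have := esym ef; rewrite ex => /(mk_eq x0_in s s Pf Px)[].
  have fl t : `|t - t0| < d -> flies gamma t0 x v s t.
    by move=> td; rewrite /flies -f0 -fE //; exact: hf.
  left; exists x, v, s; split=> //; exists d => //; split=> t h1 h2; apply: fl.
    by rewrite ger0_norm ?subr_ge0 //; lra.
  by rewrite ler0_norm ?subr_le0 //; lra.
have far j : j != i -> dot (a j) x <= b j - rho by exact: (far_from_other tr Px ex).
have bx y : P y -> dot (a i) y = b i -> boundary P y.
  by move=> Py yi; apply/(boundaryP b a_unit); split=> //; exists i.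
pose d := Num.min r (rho / 4); have d0 : 0 < d by rewrite lt_min r0 divr_gt0.
have dr t : `|t - t0| < d -> `|t - t0| < r by rewrite lt_min => /andP[].
have dr' t : `|t - t0| < d -> `|t - t0| < rho / 4 by rewrite lt_min => /andP[].
have /choice[yc hyc] : forall t, exists yc : 'rV[R]_m.+1 * bool,
    P yc.1 /\ gamma t = mk yc.1 yc.2.
  by move=> t; have [y [c [Py ey]]] := mk_surj x0_in (gamma t); exists (y, c).
pose y t := (yc t).1; pose c t := (yc t).2.
have Py t : P (y t) by have [] := hyc t.
have ey t : gamma t = mk (y t) (c t) by have [] := hyc t.
have xy t : `|t - t0| < d -> edist x (y t) = `|t - t0|.
  move=> td; have := iso t0 t; rewrite n0 => /(_ r0 (dr _ td)).
  by rewrite ex ey (mk_sheet x0_in s (c t) (bx _ Px xi) Px) mk_dist // eqxx distrC.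
pose f t := chart a b i (y t) (c t).
have [v v1 fE] : exists2 v, dot v v = 1 & forall t, `|t - t0| < d -> f t = f t0 + (t - t0) *: v.
  apply: (isometry_affine d0) => t t' td t'd.
  rewrite -(iso t t') ?dr // !ey (chart_dist a_unit bounded x0_in _ _ xi rho0 far) //.
    by rewrite xy //; apply/ltW/dr'.
  by rewrite xy //; apply/ltW/dr'.
have f0 : f t0 = x.
  have : y t0 = x.
    by have := esym (ey t0); rewrite ex => /(mk_eq x0_in (c t0) s (Py t0) Px)[].
  by rewrite /f /chart => ->; case: ifP => // _; rewrite mirror_id.
rewrite f0 in fE; pose e := dot (a i) v.
have fi t : `|t - t0| < d -> dot (a i) (f t) = b i + (t - t0) * e.
  by move=> td; rewrite fE // !dotE xi.
have fF t : c t = false -> f t = y t by rewrite /f /chart => ->.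
have fT t : c t = true -> y t = mirror (a i) (b i) (f t).
  by rewrite /f /chart => ->; rewrite mirrorK.
have cF t : `|t - t0| < d -> c t = false -> (t - t0) * e <= 0.
  by move=> td /fF h; have := Py t i; rewrite -h fi //; lra.
have cT t : `|t - t0| < d -> c t = true -> 0 <= (t - t0) * e.
  move=> td /fT h; have := Py t i; rewrite h.
  by have := dot_mirror (b i) (a_unit i) (f t); rewrite fi //; lra.
have mfE t : `|t - t0| < d -> mirror (a i) (b i) (f t) = x + (t - t0) *: reflection (a i) v.
  move=> td; have := mirrorB (a i) (b i) (f t) x; rewrite (mirror_id xi) => /eqP.
  by rewrite subr_eq => /eqP ->; rewrite fE // [x + _ - x]addrAC subrr add0r reflectionZ addrC.
have ray t : `|t - t0| < d -> c t = false -> flies gamma t0 x v false t.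
  by move=> td ct; rewrite /flies -fE // fF // -ct.
have rayT t : `|t - t0| < d -> c t = true -> flies gamma t0 x (reflection (a i) v) true t.
  by move=> td ct; rewrite /flies -mfE // -fT // -ct.
have start w c' : flies gamma t0 x w c' t0.
  by rewrite /flies subrr scale0r addr0 ex; split=> //; exact: mk_sheet (bx _ Px xi) Px.
have nrm1 t : t0 <= t -> t < t0 + d -> `|t - t0| < d.
  by move=> h1 h2; rewrite ger0_norm ?subr_ge0 //; lra.
have nrm2 t : t0 - d < t -> t <= t0 -> `|t - t0| < d.
  by move=> h1 h2; rewrite ler0_norm ?subr_le0 //; lra.
have [e0|e0|e0] := ltgtP e 0.
- right; exists x, v, false, i; split => //; exists d => //; split=> t h1 h2.
    have [->//|tt] := eqVneq t t0; apply: ray; first exact: nrm1.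
    case ct: (c t) => //; have := cT t (nrm1 _ h1 h2) ct.
    have : 0 < t - t0 by rewrite subr_gt0 lt_neqAle eq_sym tt.
    by nra.
  have [->//|tt] := eqVneq t t0; apply: rayT; first exact: nrm2.
  case ct: (c t) => //; have := cF t (nrm2 _ h1 h2) ct.
  have : t - t0 < 0 by rewrite subr_lt0 lt_neqAle tt.
  by nra.
- right; exists x, (reflection (a i) v), true, i; split => //.
  + by rewrite dot_reflection.
  + by rewrite dot_normal_reflection // oppr_lt0.
  rewrite reflectionK //; exists d => //; split=> t h1 h2.
    have [->//|tt] := eqVneq t t0; apply: rayT; first exact: nrm1.
    case ct: (c t) => //; have := cF t (nrm1 _ h1 h2) ct.
    have : 0 < t - t0 by rewrite subr_gt0 lt_neqAle eq_sym tt.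
    by nra.
  have [->//|tt] := eqVneq t t0; apply: ray; first exact: nrm2.
  case ct: (c t) => //; have := cT t (nrm2 _ h1 h2) ct.
  have : t - t0 < 0 by rewrite subr_lt0 lt_neqAle tt.
  by nra.
- left; exists x, v, false; split=> //.
  have fl t : `|t - t0| < d -> flies gamma t0 x v false t.
    move=> td; have fti : dot (a i) (f t) = b i by rewrite fi // e0 mulr0 addr0.
    have yf : y t = f t by case ct: (c t); [rewrite fT // mirror_id | rewrite fF].
    rewrite /flies -fE // -yf; split=> //; rewrite ey.
    by apply: mk_sheet => //; apply: bx => //; rewrite yf.
  by exists d => //; split=> t h1 h2; apply: fl; [exact: nrm1|exact: nrm2].
Qed.

(** Two descriptions of one flight agree, but for the sheet when the whole line
    lies in a face. *)
Lemma match_germ gamma t0 t1 x v s x1 vm sm d : t0 < t1 -> 0 < d ->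
  (forall t, t0 <= t -> t < t1 -> flies gamma t0 x v s t) ->
  (forall t, t1 - d < t -> t <= t1 -> flies gamma t1 x1 vm sm t) ->
  [/\ vm = v, x1 = x + (t1 - t0) *: v &
    sm = s \/ exists j, dot (a j) v = 0 /\ dot (a j) x1 = b j].
Proof.
move=> t01 d0 before left_.
have [lo [lo0 lod lo1]] : exists lo, [/\ t0 <= lo, t1 - d <= lo & lo < t1].
  by exists (Num.max t0 (t1 - d)); rewrite !le_max !lexx orbT gt_max t01; split=> //; lra.
have agree_ t : lo < t -> t < t1 -> P (x + (t - t0) *: v) /\
    (x + (t - t0) *: v = x1 + (t - t1) *: vm /\ (s = sm \/ boundary P (x + (t - t0) *: v))).
  move=> h1 h2; have [||Pt et] := before t; [lra|lra|].
  have [||Pt' et'] := left_ t; [lra|lra|]; split=> //.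
  by apply/(mk_eq x0_in s sm Pt Pt'); rewrite -et -et'.
have third (c : R) : 0 < c -> c < 1 -> lo < lo + c * (t1 - lo) /\ lo + c * (t1 - lo) < t1.
  by move=> c0 c1; nra.
have [h1 h2] := third (1 / 3) ltac:(lra) ltac:(lra).
have [h3 h4] := third (2 / 3) ltac:(lra) ltac:(lra).
have [h5 h6] := third (1 / 6) ltac:(lra) ltac:(lra).
have [pq rp] : lo + 1 / 3 * (t1 - lo) < lo + 2 / 3 * (t1 - lo) /\
    lo + 1 / 6 * (t1 - lo) < lo + 1 / 3 * (t1 - lo) by split; lra.
move: (lo + 1 / 3 * _) (lo + 2 / 3 * _) (lo + 1 / 6 * _) h1 h2 h3 h4 h5 h6 pq rp.
move=> p q r h1 h2 h3 h4 h5 h6 pq rp.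
have [Pp [ep sp]] := agree_ _ h1 h2; have [Pq [eq _]] := agree_ _ h3 h4.
have [Pr _] := agree_ _ h5 h6.
have vE : vm = v.
  apply: (@scalerI _ _ (q - p)); first by rewrite subr_eq0 gt_eqF.
  transitivity ((x1 + (q - t1) *: vm) - (x1 + (p - t1) *: vm)).
    by apply/rowP => i; rewrite !mxE; ring.
  by rewrite -eq -ep; apply/rowP => i; rewrite !mxE; ring.
have xE : x1 = x + (t1 - t0) *: v.
  transitivity (x1 + (p - t1) *: vm + (t1 - p) *: v).
    by rewrite vE; apply/rowP => i; rewrite !mxE; ring.
  by rewrite -ep; apply/rowP => i; rewrite !mxE; ring.
split=> //; case: sp => [->|/(boundaryP b a_unit)[_ [j pj]]]; first by left.
right; exists j.
have vj : dot (a j) v = 0.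
  apply: le_anti; apply/andP; split.
    have := Pq j; have : 0 < q - p by rewrite subr_gt0.
    by move: pj; rewrite !dotE; nra.
  have := Pr j; have : 0 < p - r by rewrite subr_gt0.
  by move: pj; rewrite !dotE; nra.
by split=> //; move: pj; rewrite xE !dotE vj !mulr0.
Qed.

(** A straight flight ends, by boundedness; and it can only end at a bounce. *)
Lemma next_bounce gamma t0 x v s d : trajectory gamma -> dot v v = 1 -> 0 < d ->
  (forall t, t0 <= t -> t < t0 + d -> flies gamma t0 x v s t) ->
  exists t1 i, [/\ t0 < t1, (forall t, t0 <= t -> t <= t1 -> flies gamma t0 x v s t) &
    bounce gamma t1 (x + (t1 - t0) *: v) (reflection (a i) v) (~~ s) i].
Proof.
move=> tr v1 d0 fly0.
pose E := [set T | t0 <= T /\ forall t, t0 <= t -> t <= T -> flies gamma t0 x v s t].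
have Et0 : E t0.
  by split=> // t h1 h2; apply: fly0 => //; rewrite (le_lt_trans h2) ?ltrDl.
have Px : P x by apply: (flies_start (fly0 t0 _ _)).1; rewrite ?ltrDl.
have supE : has_sup E.
  split; first by exists t0.
  exists (t0 + 2 * `|Mb|) => T [t0T /(_ T t0T (lexx T))[PT _]].
  have := bounded PT; have := bounded Px; rewrite -(real_normK (num_real Mb)).
  have : 0 <= `|Mb| by []; move: `|Mb| => M M0 xM yM.
  have : (T - t0) ^+ 2 <= (2 * M) ^+ 2.
    have := dotuu_ge0 (x + (x + (T - t0) *: v)); move: xM yM.
    by rewrite !dotE v1 (dotC v x); lra.
  by rewrite sqr_leP; lra.
pose t1 := sup E.
have le_t1 T : E T -> T <= t1 by exact: sup_upper_bound.
have t01 : t0 < t1.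
  suff /le_t1 : E (t0 + d / 2) by have := d0; lra.
  by split=> [|t h1 h2]; [rewrite lerDl ltW ?divr_gt0 | apply: fly0 => //; lra].
have before t : t0 <= t -> t < t1 -> flies gamma t0 x v s t.
  move=> h1 h2; have [|T [_ ET] hT] := @sup_adherent R E (t1 - t) _ supE; first by rewrite subr_gt0.
  by apply: ET => //; apply: ltW; move: hT; rewrite -/t1; lra.
have upto x1 vm sm : vm = v -> x1 = x + (t1 - t0) *: v -> flies gamma t1 x1 vm sm t1 ->
    sm = s \/ (exists j, dot (a j) v = 0 /\ dot (a j) x1 = b j) -> flies gamma t0 x v s t1.
  move=> _ xE /flies_start[Px1 e1] h; rewrite /flies -xE; split=> //; rewrite e1.
  case: h => [->//|[j [_ j1]]]; apply: mk_sheet => //.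
  by apply/(boundaryP b a_unit); split=> //; exists j.
have [[x1 [v' [s' [v'1 [d' d'0 [right_ left_]]]]]]|[x1 [v' [s' [i bn]]]]] := local_structure t1 tr.
  have [vE xE h] := match_germ t01 d'0 before left_; exfalso.
  have at1 := upto _ _ _ vE xE (left_ t1 ltac:(lra) (lexx _)) h.
  suff /le_t1 : E (t1 + d' / 2) by have := d'0; lra.
  split=> [|t h1 h2]; first by lra.
  have [tt|tt] := ltrP t t1; first exact: before.
  have [|Pt et] := right_ t tt; first by lra.
  have e : x1 + (t - t1) *: v' = x + (t - t0) *: v.
    by rewrite vE xE; apply/rowP => j; rewrite !mxE; ring.
  rewrite e in Pt et; split=> //; rewrite et.
  case: h => [->//|[j [vj j1]]]; apply: mk_sheet => //.
  by apply/(boundaryP b a_unit); split=> //; exists j; rewrite -e vE !dotE vj mulr0 addr0.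
have [xi v'1 vi [d' d'0 [right_ left_]]] := bn.
have [vE xE h] := match_germ t01 d'0 before left_.
have [Px1 e1] := flies_start (left_ t1 ltac:(lra) (lexx _)).
have sE : ~~ s' = s.
  case: h => // -[j [vj xj]].
  have ji : j != i.
    apply: contraTneq vi => ji; rewrite -(reflectionK (a_unit i) v') vE.
    by rewrite dot_normal_reflection // -ji vj oppr0 ltxx.
  have := far_from_other tr Px1 e1 xi ji; rewrite xj; have := rho0; lra.
have at1 := upto _ _ _ vE xE (left_ t1 ltac:(lra) (lexx _)) (or_introl sE).
exists t1, i; split=> //.
  by move=> t h1; rewrite le_eqVlt => /orP[/eqP ->//|]; exact: before.
by rewrite -xE -vE reflectionK // -sE negbK.
Qed.

Definition backward gamma : R -> pdouble P := fun t => gamma (- t).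

Lemma trajectory_backward gamma : trajectory gamma -> trajectory (backward gamma).
Proof.
move=> [G H]; split=> [t|t]; last exact: H.
have nn (p q : R) : `|- p - - q| = `|p - q| by rewrite opprK addrC distrC.
by have [r r0 iso] := G (- t); exists r => // s s' hs hs'; rewrite /backward iso nn.
Qed.

Lemma flies_backward gamma t0 x v s t :
  flies (backward gamma) t0 x v s t <-> flies gamma (- t0) x (- v) s (- t).
Proof. by rewrite /flies /backward -opprD scaleNr scalerN opprK. Qed.

Lemma bounce_backward gamma t x v s i : bounce gamma t x v s i ->
  bounce (backward gamma) (- t) x (- reflection (a i) v) (~~ s) i.
Proof.
move=> [xi v1 vi [d d0 [right_ left_]]]; split => //.
- by rewrite dotNl dotNr opprK dot_reflection.
- by rewrite dotNr dot_normal_reflection // opprK.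
exists d => //; split=> u h1 h2; apply/flies_backward; rewrite !opprK.
  by apply: left_; lra.
by rewrite reflectionN reflectionK // opprK negbK; apply: right_; lra.
Qed.

Record itinerary gamma (t : int -> R) (x v : int -> 'rV[R]_m.+1) (s : int -> bool)
    (f : int -> 'I_k) : Prop := Itinerary {
  it_orbit : orbit a b rho x v f;
  it_time : forall l, t l < t (l + 1);
  it_step : forall l, x (l + 1) = x l + (t (l + 1) - t l) *: v l;
  it_sheet : forall l, s (l + 1) = ~~ s l;
  it_flies : forall l u, t l <= u -> u <= t (l + 1) -> flies gamma (t l) (x l) (v l) (s l) u }.

(** The preceding bounce is the next bounce of the backward trajectory. *)
Lemma trajectory_itinerary gamma : trajectory gamma ->
  exists t (x v : int -> 'rV[R]_m.+1) s f, itinerary gamma t x v s f.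
Proof.
move=> tr.
pose T := (R * 'rV[R]_m.+1 * 'rV[R]_m.+1 * bool * 'I_k)%type.
pose S (z : T) := let: (t, x, v, s, i) := z in bounce gamma t x v s i.
pose L (z z' : T) := let: (t, x, v, s, i) := z in let: (t', x', v', s', i') := z' in
  [/\ t < t', x' = x + (t' - t) *: v, v' = reflection (a i') v, s' = ~~ s &
    forall u, t <= u -> u <= t' -> flies gamma t x v s u].
have next (z : T) : S z -> exists2 z', S z' & L z z'.
  case: z => -[[[t x] v] s] i [xi v1 vi [d d0 [right_ _]]].
  have [t1 [i1 [h1 h2 h3]]] := next_bounce tr v1 d0 right_.
  by exists (t1, x + (t1 - t) *: v, reflection (a i1) v, ~~ s, i1).
have prev (z : T) : S z -> exists2 z', S z' & L z' z.
  case: z => -[[[t x] v] s] i bn; have [xi _ _ _] := bn.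
  have [_ v1 _ [d d0 [right_ _]]] := bounce_backward bn.
  have [t1 [i1 [h1 h2 /bounce_backward]]] := next_bounce (trajectory_backward tr) v1 d0 right_.
  rewrite reflectionK // !opprK negbK; set y := x + _ => h3.
  have yE : x = y + (t - - t1) *: reflection (a i) v.
    by rewrite /y; apply/rowP => j; rewrite !mxE; ring.
  exists (- t1, y, reflection (a i) v, ~~ s, i1).
    have bb : backward (backward gamma) = gamma by apply/funext => u; rewrite /backward opprK.
    by rewrite bb in h3.
  split; [lra | by [] | by rewrite reflectionK | by rewrite negbK | ].
  move=> u u1 u2; have := h2 (- u) ltac:(lra) ltac:(lra).
  move=> /flies_backward; rewrite /flies !opprK.
  suff -> : y + (u + t1) *: reflection (a i) v = x + (u - t) *: reflection (a i) v by [].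
  by rewrite yE; apply/rowP => j; rewrite !mxE; ring.
have [z0 Sz0] : exists z0 : T, S z0.
  have [[x [v [s [v1 [d d0 [right_ _]]]]]]|[x [v [s [i bn]]]]] := local_structure 0 tr.
    have [t1 [i1 [h1 h2 h3]]] := next_bounce tr v1 d0 right_.
    by exists (t1, x + (t1 - 0) *: v, reflection (a i1) v, ~~ s, i1).
  by exists (0, x, v, s, i).
have [c hc] := two_sided_chain Sz0 next prev.
pose t (l : int) := (c l).1.1.1.1; pose X l := (c l).1.1.1.2; pose V l := (c l).1.1.2.
pose s l := (c l).1.2; pose f l := (c l).2.
have bn l : bounce gamma (t l) (X l) (V l) (s l) (f l).
  by have [] := hc l; rewrite /t /X /V /s /f; case: (c l) => -[[[? ?] ?] ?] ?.
have lk l : [/\ t l < t (l + 1), X (l + 1) = X l + (t (l + 1) - t l) *: V l,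
    V (l + 1) = reflection (a (f (l + 1))) (V l), s (l + 1) = ~~ s l &
    forall u, t l <= u -> u <= t (l + 1) -> flies gamma (t l) (X l) (V l) (s l) u].
  have [_] := hc l; rewrite /t /X /V /s /f.
  by case: (c l) (c (l + 1)) => -[[[? ?] ?] ?] ? [[[[? ?] ?] ?] ?].
exists t, X, V, s, f; split; try by move=> l; have [] := lk l.
split=> l; try by have [] := bn l.
- move=> j; have [xi _ _ _] := bn l; have [l1 _ _ _ fl] := lk l.
  have [Px e] := flies_start (fl (t l) (lexx _) (ltW l1)).
  exact: (far_from_other tr Px e xi).
- by have [] := lk l.
- by have [l1 -> _ _ _] := lk l; exists (t (l + 1) - t l) => //; rewrite subr_ge0 ltW.
- apply/eqP => e; have [xi _ vi _] := bn l; have [xi' _ _ _] := bn (l + 1).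
  have [l1 xE _ _ _] := lk l; move: xi'; rewrite e xE !dotE xi => h.
  have : 0 < t (l + 1) - t l by rewrite subr_gt0.
  by nra.
Qed.

End Geodesics.

(** * Orthogonal matrices and frames *)

Section Orthogonal.
Context {R : realType} {n : nat}.
Implicit Types (u v w a : 'rV[R]_n) (M : 'M[R]_n).

Lemma dot_mulmx u w : dot u w = (u *m w^T) 0 0.
Proof. by rewrite /dot !mxE; apply: eq_bigr => i _; rewrite !mxE. Qed.

Lemma orthogonal_dot M u w : M *m M^T = 1%:M -> dot (u *m M) (w *m M) = dot u w.
Proof. by move=> MM; rewrite !dot_mulmx trmx_mul mulmxA -(mulmxA u) MM mulmx1. Qed.

Lemma orthogonalM (M N : 'M[R]_n) : M *m M^T = 1%:M -> N *m N^T = 1%:M ->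
  (M *m N) *m (M *m N)^T = 1%:M.
Proof. by move=> MM NN; rewrite trmx_mul mulmxA -(mulmxA M) NN mulmx1. Qed.

Definition reflection_mx a : 'M[R]_n := 1%:M - 2 *: (a^T *m a).

Lemma mul_reflection_mx v a : v *m reflection_mx a = reflection a v.
Proof.
rewrite /reflection_mx mulmxBr mulmx1 -scalemxAr mulmxA [v *m _]mx11_scalar.
by rewrite -dot_mulmx mul_scalar_mx scalerA dotC.
Qed.

Lemma reflection_mx_sym a : (reflection_mx a)^T = reflection_mx a.
Proof. by rewrite /reflection_mx linearB linearZ /= trmx1 trmx_mul trmxK. Qed.

Lemma reflection_mx_orthogonal a : dot a a = 1 ->
  reflection_mx a *m (reflection_mx a)^T = 1%:M.
Proof.
move=> a1; rewrite reflection_mx_sym; apply/row_matrixP => i.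
by rewrite !rowE mulmxA !mul_reflection_mx reflectionK // mulmx1.
Qed.

(** The mirror between two unit vectors exchanges them. *)
Lemma householder u v : dot u u = 1 -> dot v v = 1 ->
  exists H : 'M[R]_n, [/\ H *m H = 1%:M, H^T = H & u *m H = v].
Proof.
move=> u1 v1; have [->|uv] := eqVneq u v; first by exists 1%:M; rewrite !mulmx1 trmx1.
have d0 : 0 < dot (u - v) (u - v).
  rewrite lt_def dotuu_ge0 andbT; apply: contra uv => /eqP/dot_eq0/eqP.
  by rewrite subr_eq0.
pose a := (enorm (u - v))^-1 *: (u - v).
have c2 : (enorm (u - v))^-1 ^+ 2 * dot (u - v) (u - v) = 1.
  by rewrite exprVn sqr_sqrtr ?ltW // mulVf // gt_eqF.
have a1 : dot a a = 1 by rewrite dotZl dotZr mulrA -expr2.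
exists (reflection_mx a); split; last 2 first.
- exact: reflection_mx_sym.
- rewrite mul_reflection_mx /reflection /a dotZl scalerA.
  set c := (enorm _)^-1 in c2 *.
  have -> : 2 * (c * dot (u - v) u) * c = 1.
    by rewrite -[RHS]c2 !dotE u1 v1 (dotC v u); ring.
  by rewrite scale1r opprB addrC subrK.
by have := reflection_mx_orthogonal a1; rewrite reflection_mx_sym.
Qed.

Lemma vanishing (c B : R) : (forall j : nat, j%:R * c <= B) -> c <= 0.
Proof.
move=> h; rewrite leNgt; apply/negP => c0; have B0 : 0 <= B by have := h 0%N; rewrite mul0r.
have := archi_boundP (divr_ge0 B0 (ltW c0)); rewrite ltr_pdivrMr // ltNge.
by rewrite h.
Qed.

(** A bounded orbit of an affine isometry forces a fixed point: the translation
    part has no component along the fixed vectors of the linear part. *)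
Lemma isometry_fixpoint M (c : 'rV[R]_n) (u : nat -> 'rV[R]_n) (B : R) :
  (forall j, u j.+1 = u j *m M + c) -> (forall j, dot (u j) (u j) <= B) ->
  exists z, z *m M + c = z.
Proof.
move=> rec bd; suff : (c <= 1%:M - M)%MS.
  by move=> /submxP[z ->]; exists z; rewrite mulmxBr mulmx1 addrC subrK.
rewrite submxE; set W := cokermx _.
have MW : M *m W = W.
  by apply/esym/eqP; rewrite -subr_eq0 -[X in X - _]mul1mx -mulmxBl mulmx_coker.
have uW j : u j *m W = u 0 *m W + j%:R *: (c *m W).
  elim: j => [|j IH]; first by rewrite scale0r addr0.
  by rewrite rec mulmxDl -mulmxA MW IH -natr1 scalerDl scale1r addrA.
have uWi j i : (u j *m W) 0 i = dot (u j) (col i W)^T.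
  by rewrite mxE; apply: eq_bigr => l _; rewrite !mxE.
apply/eqP/rowP => i; rewrite [RHS]mxE; set e := (c *m W) 0 i.
have eE j : j%:R * e = dot (u j) (col i W)^T - dot (u 0) (col i W)^T.
  have entry (p q : 'rV[R]_n) : (p + j%:R *: q) 0 i - p 0 i = j%:R * q 0 i.
    by rewrite !mxE addrC addKr.
  by rewrite -!uWi (uW j) entry.
apply: le_anti; apply/andP; split.
  apply: (@vanishing _ (B + dot (col i W)^T (col i W)^T)) => j; rewrite eE.
  have := dot_le_sum (u j) (col i W)^T; have := dot_le_sum (- u 0) (col i W)^T.
  by rewrite !dotNl !dotNr; have := bd 0%N; have := bd j; lra.
rewrite -oppr_le0; apply: (@vanishing _ (B + dot (col i W)^T (col i W)^T)) => j.
rewrite mulrN eE; have := dot_le_sum (- u j) (col i W)^T.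
have := dot_le_sum (u 0) (col i W)^T.
by rewrite !dotNl !dotNr; have := bd 0%N; have := bd j; lra.
Qed.

End Orthogonal.

(** * Families of parallel orbits with a common code *)

Lemma int_constant (T : Type) (F : int -> T) : (forall l, F (l + 1) = F l) -> forall l, F l = F 0.
Proof.
move=> h; have up (i : nat) : F i%:Z = F 0.
  by elim: i => // i <-; have -> : i.+1%:Z = i%:Z + 1 by lia.
have down (i : nat) : F (- i%:Z) = F 0.
  by elim: i => // i <-; rewrite -(h (- i.+1%:Z)); congr F; lia.
move=> l; have [->|->] : l = `|l|%N%:Z \/ l = - `|l|%N%:Z by lia.
  exact: up.
exact: down.
Qed.

Section Parallel.
Context {R : realType} {m k : nat}.
Variables (a : 'I_k -> 'rV[R]_m.+1) (b : 'I_k -> R) (Mb rho : R) (x0 : 'rV[R]_m.+1).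
Local Notation P := (halfspaces a b).
Hypothesis a_unit : forall i, dot (a i) (a i) = 1.
Hypothesis bounded : forall z, (forall j, dot (a j) z <= b j) -> dot z z <= Mb ^+ 2.
Hypothesis x0_in : forall i, dot (a i) x0 < b i.
Hypothesis rho0 : 0 < rho.
Implicit Types (gamma : R -> pdouble P) (t : int -> R) (x v : int -> 'rV[R]_m.+1).
Implicit Types (s : int -> bool) (f : int -> 'I_k).
Local Notation mk := (mk x0_in).
Local Notation itinerary := (itinerary rho x0_in).

(** The straight line carrying the [l]-th flight. *)
Definition place t x v l tau := x l + (tau - t l) *: v l.

Section One.
Variables (gamma : R -> pdouble P) (t : int -> R) (x v : int -> 'rV[R]_m.+1).
Variables (s : int -> bool) (f : int -> 'I_k).
Hypothesis it : itinerary gamma t x v s f.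

Lemma placeD l tau : place t x v l tau = place t x v l 0 + tau *: v l.
Proof. by apply/rowP => i; rewrite !mxE; ring. Qed.

Lemma place_start l : place t x v l (t l) = x l.
Proof. by rewrite /place subrr scale0r addr0. Qed.

Lemma mirror_fixes l : dot (a (f l)) (x l) = b (f l).
Proof. exact: orbit_face (it_orbit it) l. Qed.

(** The mirror fixes the bounce point and reflects the direction, and so it
    unfolds a flight into the straight continuation of the preceding one. *)
Lemma place_mirror l tau : place t x v (l + 1) tau =
  mirror (a (f (l + 1))) (b (f (l + 1))) (place t x v l tau).
Proof.
have := mirrorB (a (f (l + 1))) (b (f (l + 1))) (place t x v l tau) (x (l + 1)).
rewrite (mirror_id (mirror_fixes (l + 1))) => /eqP; rewrite subr_eq => /eqP ->.
have -> : place t x v l tau - x (l + 1) = (tau - t (l + 1)) *: v l.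
  by rewrite (it_step it) /place; apply/rowP => i; rewrite !mxE; ring.
by rewrite reflectionZ -(orbit_reflect (it_orbit it)) [LHS]addrC.
Qed.

Lemma place_face l tau : dot (a (f l)) (place t x v l tau) - b (f l) =
  (tau - t l) * dot (a (f l)) (v l).
Proof. by rewrite /place !dotE mirror_fixes; ring. Qed.

Lemma place_flies l tau : t l <= tau -> tau <= t (l + 1) ->
  P (place t x v l tau) /\ gamma tau = mk (place t x v l tau) (s l).
Proof. exact: (it_flies it). Qed.

Lemma time_gap l : rho <= t (l + 1) - t l.
Proof.
have [_ [c rc xE]] := orbit_flight a_unit rho0 l (it_orbit it).
suff -> : t (l + 1) - t l = c by [].
have := it_step it l; rewrite xE => /addrI/(congr1 (dot (v l))).
by rewrite !dotE (orbit_unit (it_orbit it)) !mulr1.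
Qed.

Lemma time_growth l (i : nat) : i%:R * rho <= t (l + i%:Z) - t l.
Proof.
elim: i => [|i IH]; first by rewrite mul0r addr0 subrr.
have -> : l + i.+1%:Z = l + i%:Z + 1 by lia.
by rewrite -natr1 mulrDl mul1r; have := time_gap (l + i%:Z); lra.
Qed.

Lemma time_cover tau : exists l, t l <= tau /\ tau < t (l + 1).
Proof.
have [N hN] : exists N : nat, `|tau - t 0| < N%:R * rho.
  exists (Num.Def.archi_bound (`|tau - t 0| / rho)).
  by rewrite -ltr_pdivrMr // archi_boundP // divr_ge0 // ltW.
have h1 := time_growth 0 N; rewrite add0r in h1.
have h2 := time_growth (- N%:Z) N; rewrite addNr in h2.
have [lo hi] : t (- N%:Z) <= tau /\ tau < t (- N%:Z + (N + N)%N%:Z).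
  have -> : - N%:Z + (N + N)%N%:Z = N%:Z by lia.
  by move: hN; rewrite ltr_norml; lra.
elim: (N + N)%N (- N%:Z) lo hi => [|i IH] l lo hi; first by move: hi; rewrite addr0; lra.
have [h|h] := ltrP tau (t (l + 1)); first by exists l.
by apply: (IH (l + 1)) => //; move: hi; congr (_ < t _); lia.
Qed.

Lemma incidence l : dot (a (f l)) (v l) != 0.
Proof. by have [/lt_eqF ->] := orbit_flight a_unit rho0 l (it_orbit it). Qed.

End One.

Section Two.
Variables (gamma gamma' : R -> pdouble P) (t t' : int -> R) (x v x' v' : int -> 'rV[R]_m.+1).
Variables (s s' : int -> bool) (f : int -> 'I_k).
Hypotheses (it : itinerary gamma t x v s f) (it' : itinerary gamma' t' x' v' s' f).

Lemma same_direction l : v l = v' l.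
Proof.
have := pair_parallel a_unit rho0 bounded (orbit_shift l (it_orbit it))
  (orbit_shift l (it_orbit it')) (fun _ _ => erefl) (lexx 0).
by rewrite add0r.
Qed.

Lemma place_dist l tau tau' :
  edist (place t x v l tau) (place t' x' v' l tau') =
  edist (place t x v 0 tau) (place t' x' v' 0 tau').
Proof.
move: l; apply: int_constant => l.
by rewrite (place_mirror it) (place_mirror it') edist_mirror.
Qed.

Lemma same_sheet : s 0 = s' 0 -> forall l, s l = s' l.
Proof.
move=> e l; apply/eqP; rewrite (@int_constant _ (fun l => s l == s' l)) ?e // => i.
by rewrite (it_sheet it) (it_sheet it'); case: (s i); case: (s' i).
Qed.

(** Two lines that are close meet the same mirror at close times, unless they are
    almost parallel to it. *)
Lemma time_close l : `|t' l - t l| * `|dot (a (f l)) (v l)| <=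
  edist (place t x v 0 0) (place t' x' v' 0 0).
Proof.
have -> : edist (place t x v 0 0) (place t' x' v' 0 0) =
    edist (place t x v l (t l)) (place t' x' v' l (t l)).
  rewrite [RHS]place_dist [in RHS](placeD t x v) [in RHS](placeD t' x' v') -same_direction.
  rewrite /Defs.edist.
  by congr enorm; apply/rowP => i; rewrite !mxE; ring.
apply: le_trans (dot_edist_le _ _ (a_unit (f l))); rewrite -normrM.
have h := place_face it l (t l); have h' := place_face it' l (t l).
rewrite -same_direction in h'.
rewrite (_ : dot _ _ - _ = (t' l - t l) * dot (a (f l)) (v l)) //; lra.
Qed.

(** The line determines the bounce times, since the bounces are transversal. *)
Lemma same_line : s 0 = s' 0 -> place t x v 0 0 = place t' x' v' 0 0 -> gamma = gamma'.
Proof.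
move=> es ep.
have et l : t' l = t l.
  have := time_close l; rewrite ep Defs.edistuu; set c := dot _ _ => h.
  have c0 : 0 < `|c| by rewrite normr_gt0 (incidence it).
  by apply/subr0_eq/normr0_eq0/le_anti; rewrite normr_ge0 andbT; nra.
have epl l tau : place t x v l tau = place t' x' v' l tau.
  apply: edist0_eq; rewrite place_dist (placeD t x v) (placeD t' x' v') ep same_direction.
  exact: Defs.edistuu.
apply/funext => tau; have [l [lo hi]] := time_cover it tau.
have [_ ->] := place_flies it lo (ltW hi).
have [||_ ->] := @place_flies _ _ _ _ _ _ it' l tau; rewrite ?et ?(ltW hi) //.
by rewrite epl (same_sheet es).
Qed.

End Two.

Section Family.
Variables (f : int -> 'I_k) (sheet0 : bool).

(** Normalized so that the orbit passes at time [0] through the hyperplane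
    orthogonal to its direction; [u] is the point of passage, in the unfolding. *)
Definition member gamma (dir u : 'rV[R]_m.+1) : Prop := exists t x v s,
  [/\ itinerary gamma t x v s f, s 0 = sheet0, v 0 = dir, place t x v 0 0 = u & dot u dir = 0].

Lemma member_unique dir gamma gamma' u :
  member gamma dir u -> member gamma' dir u -> gamma = gamma'.
Proof.
move=> [t [x [v [s [it s0 _ <- _]]]]] [t' [x' [v' [s' [it' s0' _ e _]]]]].
by apply: (same_line it it'); rewrite ?s0 ?s0' // e.
Qed.

Lemma member_direction dir dir' gamma gamma' u u' :
  member gamma dir u -> member gamma' dir' u' -> dir = dir'.
Proof.
move=> [t [x [v [s [it _ <- _ _]]]]] [t' [x' [v' [s' [it' _ <- _ _]]]]].
exact: same_direction it it' 0.
Qed.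

Lemma member_unit dir gamma u : member gamma dir u -> dot dir dir = 1.
Proof. by move=> [t [x [v [s [it _ <- _ _]]]]]; exact: orbit_unit (it_orbit it) 0. Qed.

Lemma itinerary_translate gamma t x v s (q : int) (L : R) : itinerary gamma t x v s f ->
  itinerary (fun u => gamma (u + L)) (fun l => t (l + q) - L) (fun l => x (l + q))
    (fun l => v (l + q)) (fun l => s (l + q)) (translate q f).
Proof.
move=> it; split.
- exact: orbit_shift (it_orbit it).
- by move=> l; rewrite [l + 1 + q]addrAC ltrD2r; exact: it_time it _.
- move=> l; rewrite [l + 1 + q]addrAC (it_step it); congr (_ + _ *: _); ring.
- by move=> l; rewrite [l + 1 + q]addrAC (it_sheet it).
- move=> l u; rewrite [l + 1 + q]addrAC => lo hi.
  have := it_flies it (l := l + q) (u := u + L); rewrite /flies.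
  have -> : u + L - t (l + q) = u - (t (l + q) - L) by ring.
  by apply; lra.
Qed.

Lemma member_normalize gamma t x v s : itinerary gamma t x v s f -> s 0 = sheet0 ->
  exists c u, member (fun tau => gamma (tau + c)) (v 0) u.
Proof.
move=> it s0; pose c := t 0 - dot (x 0) (v 0).
have := itinerary_translate 0 c it; rewrite translate0 => it'.
exists c, (place (fun l => t (l + 0) - c) (fun l => x (l + 0)) (fun l => v (l + 0)) 0 0).
do 4!eexists; split; [exact: it' | by rewrite /= addr0 | by rewrite /= addr0 | by [] |].
by rewrite /place /= !addr0 !dotE (orbit_unit (it_orbit it)) /c; ring.
Qed.

Lemma member_bounded dir gamma u : member gamma dir u -> dot u u <= Mb ^+ 2.
Proof.
move=> [t [x [v [s [it _ <- <-]]]]]; rewrite /place => h.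
have v1 := orbit_unit (it_orbit it) 0; have xb := orbit_bounded rho0 bounded 0 (it_orbit it).
apply: le_trans xb; move: h; rewrite !dotE v1 (dotC (v 0) (x 0)).
by have := sqr_ge0 (t 0); nra.
Qed.

Lemma orthogonal_edist (dir u u' : 'rV[R]_m.+1) (tau tau' : R) : dot dir dir = 1 ->
  dot u dir = 0 -> dot u' dir = 0 ->
  `|tau - tau'| <= edist (u + tau *: dir) (u' + tau' *: dir) /\
  edist u u' <= edist (u + tau *: dir) (u' + tau' *: dir).
Proof.
move=> v1 h h'; set e := edist (_ + _) _; have e0 : 0 <= e by exact: Defs.edist_ge0.
have e2 : e ^+ 2 = dot (u - u') (u - u') + (tau - tau') ^+ 2.
  rewrite edist_sqr.
  have -> : u + tau *: dir - (u' + tau' *: dir) = u - u' + (tau - tau') *: dir.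
    by apply/rowP => i; rewrite !mxE; ring.
  by rewrite !dotE v1 !(dotC dir) h h'; ring.
split; last by rewrite edist_le // e2 lerDl sqr_ge0.
by rewrite ler_norml -sqr_leP // e2 lerDr dotuu_ge0.
Qed.

(** Near a point of one member all members are seen in one flat chart: a sheet
    when the point is inside, the chart across the face at a bounce. *)
Lemma member_local_isometry dir gamma u tau : member gamma dir u ->
  exists2 r : R, 0 < r & forall gamma1 u1 tau1 gamma2 u2 tau2,
    member gamma1 dir u1 -> member gamma2 dir u2 ->
    edist (u + tau *: dir) (u1 + tau1 *: dir) < r ->
    edist (u + tau *: dir) (u2 + tau2 *: dir) < r ->
    ddist (gamma1 tau1) (gamma2 tau2) = edist (u1 + tau1 *: dir) (u2 + tau2 *: dir).
Proof.
move=> M; have v1 := member_unit M.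
move: M => [t [x [v [s [it s0 v0E uE uv]]]]].
have [l [lo hi]] := time_cover it tau.
have pE tau' : u + tau' *: dir = place t x v 0 tau' by rewrite placeD uE v0E.
have close j e : 0 < e -> exists2 r, 0 < r & forall gamma' t' x' v' s',
    itinerary gamma' t' x' v' s' f -> edist u (place t' x' v' 0 0) < r -> `|t' j - t j| < e.
  move=> e0; have c0 : 0 < `|dot (a (f j)) (v j)| by rewrite normr_gt0 (incidence it).
  exists (e * `|dot (a (f j)) (v j)|); first by rewrite mulr_gt0.
  move=> gamma' t' x' v' s' it'; rewrite -uE => h.
  by rewrite -(ltr_pM2r c0); apply: le_lt_trans (time_close it it' j) h.
have ort tau1 tau2 u' (uv' : dot u' dir = 0) := orthogonal_edist tau1 tau2 v1 uv uv'.
have [tl|tl] := ltrP (t l) tau.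
  pose e := Num.min (tau - t l) (t (l + 1) - tau) / 2.
  have e0 : 0 < e by rewrite divr_gt0 // lt_min !subr_gt0 tl.
  have [e1 e2] : e <= (tau - t l) / 2 /\ e <= (t (l + 1) - tau) / 2.
    by split; rewrite ler_wpM2r ?invr_ge0 // ge_min lexx ?orbT.
  have [r1 r10 close1] := close l e e0; have [r2 r20 close2] := close (l + 1) e e0.
  exists (Num.min e (Num.min r1 r2)); first by rewrite !lt_min e0 r10.
  have sheetE gamma' u' tau' : member gamma' dir u' ->
      edist (u + tau *: dir) (u' + tau' *: dir) < Num.min e (Num.min r1 r2) ->
      exists t' x' v' s', [/\ itinerary gamma' t' x' v' s' f,
        u' + tau' *: dir = place t' x' v' 0 tau', P (place t' x' v' l tau') &
        gamma' tau' = mk (place t' x' v' l tau') (s l)].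
    move=> [t' [x' [v' [s' [it' s0' v0E' uE' uv']]]]].
    have [h1 h2] := ort tau tau' u' uv'.
    rewrite !lt_min => /and3P[d0 d1 d2].
    have c1 := close1 _ _ _ _ _ it'; have c2 := close2 _ _ _ _ _ it'; rewrite uE' in c1 c2.
    have {c1} := c1 (le_lt_trans h2 d1); have {c2} := c2 (le_lt_trans h2 d2).
    have := le_lt_trans h1 d0; rewrite !ltr_norml => /andP[? ?] /andP[? ?] /andP[? ?].
    exists t', x', v', s'; rewrite (same_sheet it it') ?s0 //.
    have [||Pp e'] := @place_flies _ _ _ _ _ _ it' l tau'; [lra|lra|].
    by split=> //; rewrite [RHS]placeD uE' v0E'.
  move=> gamma1 u1 tau1 gamma2 u2 tau2 M1 M2 d1 d2.
  have [t1 [x1 [w1 [s1 [it1 -> P1 ->]]]]] := sheetE _ _ _ M1 d1.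
  have [t2 [x2 [w2 [s2 [it2 -> P2 ->]]]]] := sheetE _ _ _ M2 d2.
  by rewrite mk_dist // eqxx (place_dist it1 it2).
have {lo tl} tauE : tau = t l by apply/le_anti; rewrite tl lo.
have {}hi := it_time it l; have hl := it_time it (l - 1); rewrite subrK in hl.
pose e := Num.min (t l - t (l - 1)) (t (l + 1) - t l) / 2.
have e0 : 0 < e by rewrite divr_gt0 // lt_min !subr_gt0 hl.
have [e1 e2] : e <= (t l - t (l - 1)) / 2 /\ e <= (t (l + 1) - t l) / 2.
  by split; rewrite ler_wpM2r ?invr_ge0 // ge_min lexx ?orbT.
have [r1 r10 close1] := close (l - 1) e e0; have [r2 r20 close2] := close (l + 1) e e0.
pose r := Num.min (Num.min e (rho / 4)) (Num.min r1 r2).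
exists r; first by rewrite !lt_min e0 r10 divr_gt0.
have xl := mirror_fixes it l.
have chartE gamma' u' tau' : member gamma' dir u' ->
    edist (u + tau *: dir) (u' + tau' *: dir) < r ->
    exists t' x' v' s' y c, [/\ itinerary gamma' t' x' v' s' f,
      u' + tau' *: dir = place t' x' v' 0 tau', P y,
      edist (x l) y <= rho / 4 & gamma' tau' = mk y c /\
      chart a b (f l) y c = let p := place t' x' v' l tau' in
        if s l then mirror (a (f l)) (b (f l)) p else p].
  move=> [t' [x' [v' [s' [it' s0' v0E' uE' uv']]]]] d.
  have pE' : u' + tau' *: dir = place t' x' v' 0 tau' by rewrite [RHS]placeD uE' v0E'.
  have dl : edist (x l) (place t' x' v' l tau') = edist (u + tau *: dir) (u' + tau' *: dir).
    by rewrite -(place_start t x v) -tauE (place_dist it it') pE pE'.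
  have [h1 h2] := ort tau tau' u' uv'.
  have := d; rewrite !lt_min => /andP[/andP[d0 dr] /andP[d1 d2]].
  have c1 := close1 _ _ _ _ _ it'; have c2 := close2 _ _ _ _ _ it'; rewrite uE' in c1 c2.
  have {c1} := c1 (le_lt_trans h2 d1); have {c2} := c2 (le_lt_trans h2 d2).
  have := le_lt_trans h1 d0; rewrite !ltr_norml => /andP[? ?] /andP[? ?] /andP[? ?].
  have sE : s' l = s l by apply: (same_sheet it' it); rewrite s0.
  exists t', x', v', s'.
  have [after|before] := lerP (t' l) tau'.
    have [||Pp e'] := @place_flies _ _ _ _ _ _ it' l tau'; [lra|lra|].
    exists (place t' x' v' l tau'), (s' l); split => //; first by rewrite dl ltW.
    by split=> //; rewrite sE.
  have lE : l - 1 + 1 = l by rewrite subrK.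
  have [||Pp e'] := @place_flies _ _ _ _ _ _ it' (l - 1) tau'; [lra|rewrite lE; lra|].
  have mE := place_mirror it' (l - 1) tau'; rewrite lE in mE.
  have sE' := it_sheet it' (l - 1); rewrite lE sE in sE'.
  exists (place t' x' v' (l - 1) tau'), (s' (l - 1)); split => //.
    by rewrite -(edist_mirror_fix (a_unit (f l)) _ xl) -mE dl ltW.
  by split=> //; rewrite /chart mE sE' mirrorK //; case: (s' _).
move=> gamma1 u1 tau1 gamma2 u2 tau2 M1 M2 d1 d2.
have [t1 [x1 [w1 [s1 [y1 [c1 [it1 -> P1 q1 [-> ch1]]]]]]]] := chartE _ _ _ M1 d1.
have [t2 [x2 [w2 [s2 [y2 [c2 [it2 -> P2 q2 [-> ch2]]]]]]]] := chartE _ _ _ M2 d2.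
have far j : j != f l -> dot (a j) (x l) <= b j - rho by exact: (orbit_far (it_orbit it)).
rewrite (chart_dist a_unit bounded x0_in c1 c2 xl rho0 far P1 P2 q1 q2).
rewrite ch1 ch2 /= -(place_dist it1 it2 l).
by case: (s l); rewrite ?edist_mirror.
Qed.

End Family.
End Parallel.

(** * Periodic tubes *)

Section Axial.
Context {R : realType} {m : nat}.

Definition axis : 'rV[R]_(1 + m) := row_mx 1%:M 0.

Lemma dot_axis (A : 'M[R]_1) (z : 'rV[R]_m) : dot (row_mx A z) axis = A 0 0.
Proof.
by rewrite dot_mulmx /axis tr_row_mx mul_row_col trmx1 mulmx1 trmx0 mulmx0 addr0.
Qed.

Lemma axis_unit : dot axis axis = 1.
Proof. by rewrite dot_axis mxE. Qed.

Lemma cylE (z : 'rV[R]_m) tau : cyl z tau = tau *: axis + row_mx 0 z.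
Proof. by rewrite /cyl /axis scale_row_mx scaler0 add_row_mx addr0 add0r scalemx1. Qed.

Lemma row_mx_axis (w : 'rV[R]_(1 + m)) : dot w axis = 0 -> w = row_mx 0 (rsubmx w).
Proof.
rewrite -[w in dot w _]hsubmxK dot_axis => h; rewrite -[LHS]hsubmxK; congr row_mx.
by rewrite [LHS]mx11_scalar h; apply/matrixP => i j; rewrite !mxE mul0rn.
Qed.

Lemma axial_row (Q : 'M[R]_(1 + m)) (z : 'rV[R]_m) : Q *m Q^T = 1%:M -> axis *m Q = axis ->
  row_mx 0 z *m Q = row_mx 0 (z *m drsubmx Q).
Proof.
move=> QQ Qa; rewrite [LHS]row_mx_axis.
  by rewrite -[Q in LHS]submxK mul_row_block row_mxKr mul0mx add0r.
by rewrite -{1}Qa orthogonal_dot // dot_axis mxE.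
Qed.

End Axial.

Section Tubes.
Context {R : realType} {m k : nat}.
Variables (a : 'I_k -> 'rV[R]_m.+1) (b : 'I_k -> R) (Mb rho : R) (x0 : 'rV[R]_m.+1).
Local Notation P := (halfspaces a b).
Hypothesis a_unit : forall i, dot (a i) (a i) = 1.
Hypothesis bounded : forall z, (forall j, dot (a j) z <= b j) -> dot z z <= Mb ^+ 2.
Hypothesis x0_in : forall i, dot (a i) x0 < b i.
Hypothesis rho0 : 0 < rho.
Implicit Types (gamma : R -> pdouble P) (t : int -> R) (x v : int -> 'rV[R]_m.+1).
Implicit Types (s : int -> bool).
Variables (f : int -> 'I_k) (sheet0 : bool).
Local Notation itinerary := (itinerary rho x0_in).
Local Notation member := (member rho x0_in f sheet0).

(** The linear part of the unfolding isometry after [l] bounces. *)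
Fixpoint turn (l : nat) : 'M[R]_m.+1 :=
  if l is l'.+1 then turn l' *m reflection_mx (a (f (l'%:Z + 1))) else 1%:M.

Lemma turn_orthogonal l : turn l *m (turn l)^T = 1%:M.
Proof.
elim: l => [|l IH] /=; first by rewrite trmx1 mulmx1.
exact: orthogonalM IH (reflection_mx_orthogonal (a_unit _)).
Qed.

Lemma turn_direction gamma t x v s l : itinerary gamma t x v s f ->
  v l%:Z = v 0 *m turn l.
Proof.
move=> it; elim: l => [|l IH]; first by rewrite mulmx1.
rewrite /= mulmxA -IH mul_reflection_mx -(orbit_reflect (it_orbit it)); congr v; lia.
Qed.

Lemma turn_place gamma gamma' t t' x v x' v' s s' l tau :
  itinerary gamma t x v s f -> itinerary gamma' t' x' v' s' f ->
  place t x v l%:Z tau - place t' x' v' l%:Z tau =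
  (place t x v 0 tau - place t' x' v' 0 tau) *m turn l.
Proof.
move=> it it'; elim: l => [|l IH]; first by rewrite mulmx1.
have -> : l.+1%:Z = l%:Z + 1 by lia.
by rewrite (place_mirror it) (place_mirror it') mirrorB /= mulmxA -IH mul_reflection_mx.
Qed.

Lemma sheet_even gamma t x v s (q : nat) : itinerary gamma t x v s f -> ~~ odd q -> s q%:Z = s 0.
Proof.
move=> it; suff -> : s q%:Z = odd q (+) s 0 by move=> /negbTE ->.
elim: q => // q IH; have -> : q.+1%:Z = q%:Z + 1 by lia.
by rewrite (it_sheet it) IH /=; case: (odd q); case: (s 0).
Qed.

(** After an even period, long enough to move forward, the members return: the
    first-return map of the cross-section is an affine isometry. *)
Lemma member_return dir gamma u (q : nat) : member gamma dir u ->
  (forall l, f (l + q%:Z) = f l) -> ~~ odd q -> 2 * `|Mb| < q%:R * rho ->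
  exists (L : R) (M : 'M[R]_m.+1) (c : 'rV[R]_m.+1),
  [/\ 0 < L, M *m M^T = 1%:M, dir *m M = dir &
    forall gamma1 u1, member gamma1 dir u1 ->
      member (fun tau => gamma1 (tau + L)) dir (u1 *m M + c)].
Proof.
move=> [t [x [v [s [it s0 vE uE uv]]]]] fq qe qlarge.
have fE : translate q%:Z f = f by apply/funext => l; exact: fq.
have dir1 : dot dir dir = 1 by rewrite -vE (orbit_unit (it_orbit it)).
pose L := - dot (place t x v q%:Z 0) dir.
have vq gamma1 t1 x1 v1 s1 : itinerary gamma1 t1 x1 v1 s1 f -> v1 q%:Z = dir.
  move=> it1; have := itinerary_translate q%:Z L it1; rewrite fE => it1'.
  have := same_direction a_unit bounded rho0 it1' it 0.
  by rewrite add0r vE.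
have MM := turn_orthogonal q; have dM : dir *m turn q = dir.
  by rewrite -{1}vE -(turn_direction _ it) (vq _ _ _ _ _ it).
exists L, (turn q), (place t x v q%:Z L - u *m turn q); split => //.
  have t0E : t 0 = dot (x 0) dir.
    by move: uv; rewrite -uE /place vE !dotE dir1; lra.
  rewrite /L /place (vq _ _ _ _ _ it) !dotE dir1.
  have tq := time_growth a_unit rho0 it 0 q; rewrite add0r in tq.
  have xb := orbit_bounded rho0 bounded 0 (it_orbit it).
  have yb := orbit_bounded rho0 bounded q%:Z (it_orbit it).
  have : dot dir (x q%:Z - x 0) ^+ 2 <= (2 * `|Mb|) ^+ 2.
    apply: le_trans (bessel _ dir1) _; rewrite exprMn real_normK ?num_real //.
    have := dotuu_ge0 (x q%:Z + x 0); move: xb yb.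
    by rewrite !dotE (dotC (x 0) (x q%:Z)); lra.
  rewrite sqr_leP ?mulr_ge0 // dotBr !(dotC dir) => /andP[_ h].
  by move: tq h qlarge; rewrite t0E; lra.
move=> gamma1 u1 [t1 [x1 [v1 [s1 [it1 s10 v1E u1E u1v]]]]].
have := itinerary_translate q%:Z L it1; rewrite fE => it1'.
have pE : place t1 x1 v1 q%:Z L = u1 *m turn q + (place t x v q%:Z L - u *m turn q).
  rewrite addrCA -mulmxBl -[LHS](subrK (place t x v q%:Z L)) addrC; congr (_ + _).
  rewrite (turn_place _ _ it1 it) (placeD t1) (placeD t) u1E uE vE v1E; congr (_ *m _).
  by apply/rowP => i; rewrite !mxE; ring.
exists (fun l => t1 (l + q%:Z) - L), (fun l => x1 (l + q%:Z)), (fun l => v1 (l + q%:Z)),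
  (fun l => s1 (l + q%:Z)); split => //.
- by rewrite /= add0r (sheet_even it1).
- by rewrite /= add0r (vq _ _ _ _ _ it1).
- rewrite -pE /place /= !add0r; congr (_ + _ *: _); ring.
rewrite addrCA -mulmxBl dotDl -{2}dM orthogonal_dot // dotBl u1v uv subrr addr0.
by rewrite (placeD t) (vq _ _ _ _ _ it) dotDl dotZl dir1 /L mulr1 addrN.
Qed.

Lemma empty_tube : exists T : tube P, periodic_tube T /\ forall z, ~ cross_section T z.
Proof.
pose F (p : 'rV[R]_m * R) := mk x0_in x0 true.
have reg z tau : (set0 : set 'rV[R]_m) z -> regular_part (F (z, tau)) by [].
have iso : local_isometry (@cyl_dist R m) (@ddist R m P) (set0 `*` setT) F by move=> p [].
exists (Tube reg iso); split; last by move=> z [].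
exists 1, 1%:M; split => //.
by split; rewrite ?trmx1 ?mulmx1 // det1.
Qed.

(** The tube is filled by the normalized orbits with the code [f] that start on
    the sheet [sheet0]. Its axis passes through a fixed point of the return map;
    returning twice makes the determinant of the rotation positive. *)
Lemma tube_of_members : code_of a b rho f ->
  exists T : tube P, periodic_tube T /\
    forall gamma t x v s, itinerary gamma t x v s f -> s 0 = sheet0 ->
      (forall tau, regular_part (gamma tau)) -> belongs_to -oo%E +oo%E gamma T.
Proof.
move=> codef.
have [[gamma0 [t [x [v [s [it s0 reg0]]]]]]|none] := pselect (exists gamma t x v s,
    [/\ itinerary gamma t x v s f, s 0 = sheet0 &
      forall tau, regular_part (gamma tau)]); last first.
  have [T [perT _]] := empty_tube; exists T; split=> // gamma t x v s it s0 reg.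
  by case: none; exists gamma, t, x, v, s.
have [c1 [u1]] := member_normalize it s0; set gamma1 := fun tau => _; set dir := v 0 => mem1.
have reg1 tau : regular_part (gamma1 tau) by exact: reg0.
have dir1 := member_unit mem1.
have [p p0 fp] := bounce_codes_periodic a_unit rho0 bounded codef.
(* The multiple [2 * N] of the period is even, which restores the sheet, and so
   large that the return goes forward in time. *)
pose N := (Num.Def.archi_bound (2 * `|Mb| / rho)).+1.
have [|||L [M [c [L0 MM dM ret]]]] := member_return (q := (2 * (p * N))%N) mem1.
- move=> l; have per (i : nat) : f (l + (i * p)%N%:Z) = f l.
    elim: i => [|i IH]; first by rewrite mul0n addr0.
    by rewrite -IH -[RHS]fp; congr f; lia.
  by rewrite -(per (2 * N)%N); congr (f (l + _)); lia.
- by rewrite oddM.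
- have B0 : 0 <= 2 * `|Mb| / rho by rewrite divr_ge0 ?mulr_ge0 // ltW.
  have := archi_boundP B0; rewrite ltr_pdivrMr // => h; apply: lt_le_trans h _.
  by apply: ler_wpM2r; [exact: ltW | rewrite ler_nat /N; nia].
pose u (j : nat) := iter j (fun u => u *m M + c) u1.
have memu j : exists gamma, member gamma dir (u j).
  by elim: j => [|j [gamma IH]]; [exists gamma1 | eexists; exact: ret IH].
have [z0 z0E] : exists z, z *m M + c = z.
  apply: (@isometry_fixpoint _ _ M c u (Mb ^+ 2)) => // j.
  by have [gamma] := memu j; exact: member_bounded.
pose c0 := z0 - dot z0 dir *: dir.
have c0E : c0 *m M + c = c0.
  by rewrite mulmxBl -scalemxAl dM addrAC z0E.
have c0d : dot c0 dir = 0 by rewrite /c0 !dotE dir1; ring.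
have [H [HH HT aH]] := householder (@axis_unit R m) dir1.
have HO : H *m H^T = 1%:M by rewrite HT.
have dH : dir *m H = axis by rewrite -aH -mulmxA HH mulmx1.
pose iota (z : 'rV[R]_m) : 'rV[R]_m.+1 := c0 + row_mx 0 z *m H.
pose V : set 'rV[R]_m := [set z | exists2 gamma, forall tau, regular_part (gamma tau) &
  member gamma dir (iota z)].
have /choice[g gP] : forall z, exists gamma, V z ->
    (forall tau, regular_part (gamma tau)) /\ member gamma dir (iota z).
  move=> z; have [[gamma h1 h2]|nV] := pselect (V z); first by exists gamma.
  by exists gamma1.
pose F (zt : 'rV[R]_m * R) := g zt.1 zt.2.
have reg z tau : V z -> regular_part (F (z, tau)) by move=> /gP[h _]; exact: h.
have cylE' z tau z' tau' : cyl_dist (z, tau) (z', tau') =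
    edist (iota z + tau *: dir) (iota z' + tau' *: dir).
  rewrite /cyl_dist /Defs.edist /enorm -[dot (cyl _ _ - _) _](orthogonal_dot _ _ HO).
  suff -> : (cyl z tau - cyl z' tau') *m H = iota z + tau *: dir - (iota z' + tau' *: dir) by [].
  rewrite /= !cylE mulmxBl !mulmxDl -!scalemxAl aH /iota.
  by apply/rowP => i; rewrite !mxE; ring.
have iso : local_isometry (@cyl_dist R m) (@ddist R m P) (V `*` setT) F.
  move=> [z tau] [/= Vz _]; have [_ mz] := gP z Vz.
  have [r r0 hr] := member_local_isometry a_unit bounded rho0 tau mz.
  exists r => // -[z' tau'] [z'' tau''] [/= Vz' _] [/= Vz'' _]; rewrite !cylE' => d' d''.
  by apply: hr d' d''; [exact: (gP _ Vz').2 | exact: (gP _ Vz'').2].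
exists (Tube reg iso); split; last first.
  move=> gamma t' x' v' s' it' s0' reg'; split => //=.
  have [c2 [u2 mem2]] := member_normalize it' s0'.
  have dE := member_direction a_unit bounded rho0 mem2 mem1; rewrite dE in mem2.
  pose w := (u2 - c0) *m H; pose z : 'rV[R]_m := rsubmx w.
  have wE : w = row_mx 0 z.
    apply: row_mx_axis; rewrite -dH (orthogonal_dot _ _ HO) dotBl c0d subr0.
    by have [? [? [? [? []]]]] := mem2.
  have zE : iota z = u2 by rewrite /iota -wE /w -mulmxA HH mulmx1 addrC subrK.
  have Vz : V z by exists (fun tau => gamma (tau + c2)); rewrite ?zE.
  exists z, (- c2); split=> // tau.
  have [_ gz] := gP z Vz; rewrite zE in gz.
  by rewrite /F /= (member_unique a_unit bounded rho0 gz mem2) subrK.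
pose Q0 : 'M[R]_(1 + m) := H *m M *m H.
have Q0O : Q0 *m Q0^T = 1%:M by apply: orthogonalM => //; exact: orthogonalM.
have Q0a : axis *m Q0 = axis by rewrite /Q0 !mulmxA aH dM dH.
pose Q := Q0 *m Q0.
have QO : Q *m Q^T = 1%:M by exact: orthogonalM.
have Qa : axis *m Q = axis by rewrite mulmxA !Q0a.
have step z : V z -> V (z *m drsubmx Q0) /\ forall tau, g z (tau + L) = g (z *m drsubmx Q0) tau.
  move=> Vz; have [rz mz] := gP z Vz.
  have iE : iota z *m M + c = iota (z *m drsubmx Q0).
    rewrite /iota -(axial_row _ Q0O Q0a) /Q0 -!mulmxA HH mulmx1 mulmxDl addrAC c0E.
    by rewrite !mulmxA.
  have mz' := ret _ _ mz; rewrite iE in mz'.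
  have Vz' : V (z *m drsubmx Q0) by exists (fun tau => g z (tau + L)).
  split=> // tau; have := member_unique a_unit bounded rho0 mz' (gP _ Vz').2.
  by move=> /(congr1 (@^~ tau)).
exists (L + L), Q; split; first by rewrite addr_gt0.
  split=> //.
  have : \det Q0 * \det Q0 = 1 by rewrite -{2}(det_tr Q0) -det_mulmx Q0O det1.
  by move=> <-; exact: det_mulmx.
move=> z Vz; have [Vz' e'] := step z Vz; have [Vz'' e''] := step _ Vz'.
have zQ : z *m drsubmx Q = z *m drsubmx Q0 *m drsubmx Q0.
  have := axial_row z QO Qa; rewrite mulmxA !(axial_row _ Q0O Q0a).
  by move=> /eq_row_mx[].
rewrite /= zQ; split=> // tau.
by rewrite /F /= addrA e' e''.
Qed.

End Tubes.

(** * The finite tube condition *)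

Section Conclusion.
Context {R : realType} {m : nat}.

(** An end of a maximal trajectory at finite time lies in every neighbourhood of
    the singular set. *)
Lemma avoiding_orbit_complete (P : set 'rV[R]_m.+1) (eps : R) (a b : \bar R)
    (gamma : R -> pdouble P) :
  0 < eps -> is_orbit a b gamma -> orbit_avoids a b gamma (singular_nbhd (P := P) eps) ->
  a = -oo%E /\ b = +oo%E.
Proof.
move=> eps0 [ab _ _ ha hb] av; split.
  case: a ab ha av => [t0| |] // ab ha av; last by move: ab; rewrite ltNge leey.
  have [z sz lim] := ha t0 erefl; exfalso.
  have [b' [t0b' b'b]] : exists b', t0 < b' /\ (b'%:E <= b)%E.
    case: b ab {hb av ha} => [r| |] //; first by rewrite lte_fin => h; exists r; rewrite h.
    by exists (t0 + 1); rewrite ltrDl leey.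
  have near1 : \forall t \near t0^'+, ddist (gamma t) z < eps.
    by apply: (lim [set r | r < eps]); apply: open_nbhs_nbhs; split; [exact: open_lt | ].
  have pr := at_right_proper_filter t0.
  have /filter_ex[t [d [lt tlt]]] : \forall t \near t0^'+,
      ddist (gamma t) z < eps /\ (t0 < t /\ t < b').
    by apply: filterI near1 _; apply: filterI; [exact: nbhs_right_gt|exact: nbhs_right_lt].
  apply: (av t); last by exists z.
    by rewrite lte_fin.
  by apply: lt_le_trans b'b; rewrite lte_fin.
case: b ab hb av => [t0| |] // ab hb av; last by move: ab; rewrite ltNge leNye.
have [z sz lim] := hb t0 erefl; exfalso.
have [a' [a't0 aa']] : exists a', a' < t0 /\ (a <= a'%:E)%E.
  case: a ab {hb av ha} => [r| |] //; first by rewrite lte_fin => h; exists r; rewrite h.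
  by exists (t0 - 1); rewrite ltrBlDr ltrDl leNye.
have near1 : \forall t \near t0^'-, ddist (gamma t) z < eps.
  by apply: (lim [set r | r < eps]); apply: open_nbhs_nbhs; split; [exact: open_lt | ].
have pl := at_left_proper_filter t0.
have /filter_ex[t [d [lt tlt]]] : \forall t \near t0^'-,
    ddist (gamma t) z < eps /\ (t < t0 /\ a' < t).
  by apply: filterI near1 _; apply: filterI; [exact: nbhs_left_lt|exact: nbhs_left_gt].
apply: (av t); last by exists z.
  by apply: le_lt_trans aa' _; rewrite lte_fin.
by rewrite lte_fin.
Qed.

End Conclusion.

Theorem theorem3p12 (R : realType) (m : nat) (P : set 'rV[R]_m.+1)
    (hP : convex_polyhedron P) (eps : R) (heps : 0 < eps) :
  finite_tube_condition (singular_nbhd (P := P) eps).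
Proof.
have [k [a [b [Mb [PE a_unit ab_inj bounded [x0 x0_in]]]]]] := polyhedron_normal_form hP.
have {hP}PE : P = halfspaces a b by exact: PE.
subst P.
have [rho rho0 gap] := uniform_gap a_unit ab_inj bounded x0_in heps.
have fin := bounce_codes_finite a_unit rho0 bounded.
have [codes codesE] := (finite_seqP _).1 fin.
have codeP (i : 'I_(size codes)) : code_of a b rho (tnth (in_tuple codes) i).
  have : [set` codes] (tnth (in_tuple codes) i) by exact: mem_tnth.
  by rewrite -codesE.
have /choice[T hT] : forall is_ : 'I_(size codes) * bool, exists T : tube (halfspaces a b),
    periodic_tube T /\ forall gamma t x v s,
      itinerary rho x0_in gamma t x v s (tnth (in_tuple codes) is_.1) -> s 0 = is_.2 ->
      (forall tau, regular_part (gamma tau)) -> belongs_to -oo%E +oo%E gamma T.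
  by move=> [i s0]; exact: (tube_of_members a_unit bounded x0_in rho0 s0 (codeP i)).
exists #|{: 'I_(size codes) * bool}|, (fun i => T (enum_val i)); split.
  by move=> i; have [] := hT (enum_val i).
move=> A B gamma orb av.
have [AE BE] := avoiding_orbit_complete heps orb av; subst A B.
have [_ reg iso _ _] := orb.
have av' tau : ~ singular_nbhd eps (gamma tau) by apply: av; rewrite ?ltNyr ?ltry.
have tr : trajectory rho x0_in gamma.
  split=> [tau|tau x s Px e i j].
    have [|r r0 h] := iso tau; first by split; rewrite ?ltNyr ?ltry.
    exists r => // s s' hs hs'; apply: h; rewrite ?[`|tau - _|]distrC //.
      by split; rewrite ?ltNyr ?ltry.
    by split; rewrite ?ltNyr ?ltry.
  apply: gap => // z sz Pz; apply: (avoid_far (x0_in := x0_in) (s := s)) sz Pz => //.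
  by rewrite -e; exact: av'.
have [t [x [v [s [f it]]]]] := trajectory_itinerary a_unit bounded rho0 tr.
have : [set` codes] f by rewrite -codesE; exists x, v; exact: it_orbit it.
move=> /= fc; have [i fE] : exists i, f = tnth (in_tuple codes) i by apply/tnthP.
exists (enum_rank (i, s 0)); rewrite enum_rankK.
have [_ h] := hT (i, s 0); apply: (h _ t x v s) => //=; first by rewrite -fE.
by move=> tau; apply: reg; split; rewrite ?ltNyr ?ltry.
Qed.
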